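(* Let $\Gamma=\langle S_\Gamma\rangle$ be a finitely generated group with a fixed finite generating system, and let $\Lambda\leq\Gamma$ be a finite index subgroup. Let $m_\Lambda$ and $m_\Gamma$ be the Haar probability measures on $\mathrm{Iso}(\Gamma)/\Lambda$ and $\mathrm{Iso}(\Gamma)/\Gamma$ respectively, and let $u$ be the uniform probability measure on $\Gamma/\Lambda$. Then the p.m.p. action $\Gamma\curvearrowright(\mathrm{Iso}(\Gamma)/\Lambda,m_\Lambda)$ is isometric orbit equivalent (with respect to $S_\Gamma$ for both actions) to the diagonal action $\Gamma\curvearrowright(\mathrm{Iso}(\Gamma)/\Gamma\times\Gamma/\Lambda,\,m_\Gamma\otimes u)$.
   Context: A finite generating system is a finite symmetric generating set not containing the identity. The Cayley graph $(\Gamma,S_\Gamma)$ has vertex set $\Gamma$ and edges $\{\gamma,\gamma s\}$, $s\in S_\Gamma$, with the graph distance. $\mathrm{Iso}(\Gamma)$ is the group of bijective isometries of $(\Gamma,S_\Gamma)$, a locally compact totally disconnected unimodular group for the topology of pointwise convergence, containing $\Gamma$ as left translations. For a finite index subgroup $\Lambda\leq\Gamma$ (possibly $\Lambda=\Gamma$), $\mathrm{Iso}(\Gamma)/\Lambda$ denotes the quotient of $\mathrm{Iso}(\Gamma)$ by the action of $\Lambda$ by postcomposition, $\lambda\cdot f:\gamma\mapsto\lambda f(\gamma)$. $\mathrm{Iso}(\Gamma)$, hence $\Gamma$, acts on it by precomposition by the inverse, $g[f]=[f\circ g^{-1}]$. The Haar probability measure on $\mathrm{Iso}(\Gamma)/\Lambda$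 is the image of the normalized restriction of the Haar measure of $\mathrm{Iso}(\Gamma)$ to a measurable fundamental domain of $\Lambda$; it is the unique $\mathrm{Iso}(\Gamma)$-invariant Borel probability measure. $\Gamma/\Lambda$ is the set of left cosets, on which $\Gamma$ acts by left multiplication. Isometric orbit equivalence: for a p.m.p. action $\alpha$ of $\Gamma$ on $(X,\mu)$ (an action by measure-preserving bimeasurable bijections of a standard probability space), let $d_{\alpha(S_\Gamma)}(x,x')\in\mathbb{N}\cup\{+\infty\}$ be the graph distance on the graph with vertex set $X$ and edge set $\{(x,x') : \exists s\in S_\Gamma,\ \alpha(s)x=x'\}$. Two p.m.p. actions $\Gamma\curvearrowright^\alpha(X,\mu)$ and $\Gamma\curvearrowright^\beta(Y,\nu)$ are isometric orbit equivalent if there exist a bimeasurable bijection $\Phi:X\to Y$ with $\Phi_*\mu=\nu$ and an $\alpha$-invariant measurable set $X_0\subseteq X$ with $\mu(X_0)=1$ such that $\Phi(X_0)$ is $\beta$-invariant and $d_{\beta(S_\Gamma)}(\Phi(x),\Phi(x'))=d_{\alpha(S_\Gamma)}(x,x')$ for all $x,x'\in X_0$. *)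

(* Defs.v *)
From HB Require Import structures.
From mathcomp Require Import all_boot all_order all_algebra.
From mathcomp Require Import all_classical all_reals all_analysis.

Set Implicit Arguments.
Unset Strict Implicit.
Unset Printing Implicit Defensive.

Import Order.TTheory GRing.Theory Num.Theory.

Local Open Scope classical_set_scope.
Local Open Scope quotient_scope.
Local Open Scope ring_scope.
Local Open Scope group_scope.

Fixpoint walk (T : Type) (E : T -> T -> Prop) (n : nat) (x y : T) : Prop :=
  if n is n'.+1 then exists2 z, E x z & walk E n' z y else x = y.

(* [walk] follows edges in the given direction; every relation [E] used below
   is symmetric, so this is the distance in the undirected graph.  The value is
   [+oo] between different connected components. *)
Definition gdist (T : Type) (E : T -> T -> Prop) (x y : T) : \bar nat :=
  if pselect (exists n, `[< walk E n x y >]) is left h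
  then EFin (ex_minn h) else +oo%E.

(* The last clause: the only subgroup of [G] containing [S] is [G]. *)
Definition generating_system (G : groupType) (S : set G) : Prop :=
  [/\ finite_set S,
      ~ S 1,
      forall s, S s -> S s^-1 &
      forall H : groupClosed G,
        (forall s, S s -> s \in H) -> forall x, x \in H].

Definition cayley_adj (G : groupType) (S : set G) (x y : G) : Prop :=
  exists2 s, S s & y = x * s.

Section Whole.
Variable G : groupType.

Definition whole_pred : {pred G} := fun=> true.

Let wholeV : invg_closed whole_pred. Proof. by []. Qed.
Let whole1 : 1 \in whole_pred. Proof. by []. Qed.
Let wholeM : mulg_closed whole_pred. Proof. by []. Qed.
HB.instance Definition _ := isInvClosed.Build _ whole_pred wholeV.
HB.instance Definition _ := isMulClosed.Build _ whole_pred wholeM.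
HB.instance Definition _ := monoid.isMul1Closed.Build _ whole_pred whole1.

Definition whole : groupClosed G := GroupClosed.clone G whole_pred _.
End Whole.
Arguments whole : clear implicits.

Section Cosets.
Variables (G : groupType) (L : groupClosed G).

Definition lcoset_rel : rel G := fun x y => x^-1 * y \in L.

Let lcoset_refl : reflexive lcoset_rel.
Proof. by move=> x; rewrite /lcoset_rel mulVg gpred1. Qed.

Let lcoset_sym : symmetric lcoset_rel.
Proof.
by move=> x y; rewrite /lcoset_rel -(gpredV L (y^-1 * x)) invgM invgK.
Qed.

Let lcoset_trans : transitive lcoset_rel.
Proof.
move=> y x z xy yz; rewrite /lcoset_rel.
by rewrite -[z](mulVKg y) mulgA gpredM.
Qed.

Canonical lcoset_equiv :=
  EquivRel lcoset_rel lcoset_refl lcoset_sym lcoset_trans.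

Definition cosets : Type := {eq_quot lcoset_equiv}.
HB.instance Definition _ := Choice.copy cosets {eq_quot lcoset_equiv}.
HB.instance Definition _ := Quotient.copy cosets {eq_quot lcoset_equiv}.
HB.instance Definition _ := EqQuotient.copy cosets {eq_quot lcoset_equiv}.
HB.instance Definition _ := isPointed.Build cosets (\pi_cosets 1).
HB.instance Definition _ := isMeasurable.Build default_measure_display
  cosets (@discrete_measurable0 cosets) (@discrete_measurableC cosets)
  (@discrete_measurableU cosets).

Definition finite_index : Prop := finite_set [set: cosets].

Definition coset_act (g : G) (c : cosets) : cosets := \pi_cosets (g * repr c).

Lemma coset_actE (g x : G) : coset_act g (\pi x) = \pi_cosets (g * x).
Proof.
apply/eqquotP; rewrite /= /lcoset_rel invgM -mulgA mulKg.
by have /eqquotP := reprK (\pi_cosets x).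
Qed.

(* Normalized counting measure.  [mnormalize] returns its last argument when
   the total mass is 0 or [+oo], which cannot happen if [L] has finite index. *)
Definition coset_unif (R : realType) : probability cosets R :=
  mnormalize (@counting cosets R) (dirac point).

End Cosets.

Section Isometries.
Variables (G : groupType) (S : set G).
Local Notation dS := (gdist (cayley_adj S)).

Definition isometries : set {ptws G -> discrete_topology G} :=
  [set f | bijective f /\ forall x y, dS (f x) (f y) = dS x y].

(* Topology of pointwise convergence, [G] being discrete. *)
Definition Iso : Type := set_type isometries.
HB.instance Definition _ := Choice.on Iso.
HB.instance Definition _ := SubType.on Iso.
HB.instance Definition _ := Topological.copy Iso (set_type isometries).

Definition iso_fun (f : Iso) : G -> G := val f.

Lemma iso_funP (f : Iso) :
  bijective (iso_fun f) /\
  forall x y, dS (iso_fun f x) (iso_fun f y) = dS x y.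
Proof. by have := valP f; rewrite inE. Qed.

Lemma iso_inj (f g : Iso) : iso_fun f =1 iso_fun g -> f = g.
Proof. by move=> fg; apply/val_inj/funext. Qed.

Lemma iso_comp_subproof (f g : Iso) :
  (iso_fun f \o iso_fun g : {ptws G -> discrete_topology G}) \in isometries.
Proof.
have [[bf df] [bg dg]] := (iso_funP f, iso_funP g).
by rewrite inE; split; [exact: bij_comp | move=> x y /=; rewrite df dg].
Qed.

Definition iso_comp (f g : Iso) : Iso := exist (fun h => h \in isometries) _ (iso_comp_subproof f g).

Lemma walk_mulg (g : G) n x y :
  walk (cayley_adj S) n x y -> walk (cayley_adj S) n (g * x) (g * y).
Proof.
elim: n x => [x ->//|n IHn x [_ [s Ss ->] /IHn w]].
by exists (g * (x * s)) => //; exists s => //; rewrite mulgA.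
Qed.

Lemma gdist_mulg (g x y : G) : dS (g * x) (g * y) = dS x y.
Proof.
pose F (P : pred nat) : \bar nat :=
  if pselect (exists n, P n) is left h then EFin (ex_minn h) else +oo%E.
rewrite -[LHS]/(F (fun n => `[< walk _ n _ _ >])).
rewrite -[RHS]/(F (fun n => `[< walk _ n _ _ >])).
congr F; apply/funext => n; apply: asbool_equiv_eq; split; last exact: walk_mulg.
by move/(walk_mulg g^-1); rewrite !mulKg.
Qed.

Lemma ltrans_subproof (g : G) :
  ((fun x => g * x) : {ptws G -> discrete_topology G}) \in isometries.
Proof.
rewrite inE; split; last exact: gdist_mulg.
by exists (fun x => g^-1 * x) => x; rewrite ?mulKg ?mulVKg.
Qed.

Definition ltrans (g : G) : Iso := exist (fun h => h \in isometries) _ (ltrans_subproof g).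

Lemma iso_compE (f g : Iso) x :
  iso_fun (iso_comp f g) x = iso_fun f (iso_fun g x).
Proof. by []. Qed.

Lemma ltransE (g x : G) : iso_fun (ltrans g) x = g * x.
Proof. by []. Qed.

HB.instance Definition _ := isPointed.Build Iso (ltrans 1).

End Isometries.

Section IsoQuotient.
Variables (G : groupType) (S : set G) (L : groupClosed G).

Definition orbit_rel : rel (Iso S) :=
  fun f f' => `[< exists2 l, l \in L & f' = iso_comp (ltrans S l) f >].

Let orbit_refl : reflexive orbit_rel.
Proof.
move=> f; apply/asboolP; exists 1; first exact: gpred1.
by apply: iso_inj => x; rewrite iso_compE ltransE mul1g.
Qed.

Let orbit_sym : symmetric orbit_rel.
Proof.
suff sub f f' : orbit_rel f f' -> orbit_rel f' f.
  by move=> f f'; apply/idP/idP; exact: sub.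
move=> /asboolP[l Ll ->]; apply/asboolP; exists l^-1; first by rewrite gpredV.
by apply: iso_inj => x; rewrite !iso_compE !ltransE mulKg.
Qed.

Let orbit_trans : transitive orbit_rel.
Proof.
move=> f' f f'' /asboolP[l Ll ->] /asboolP[k Lk ->]; apply/asboolP.
exists (k * l); first exact: gpredM.
by apply: iso_inj => x; rewrite !iso_compE !ltransE mulgA.
Qed.

Canonical orbit_equiv := EquivRel orbit_rel orbit_refl orbit_sym orbit_trans.

Definition iso_quot : Type := quotient_topology {eq_quot orbit_equiv}.
HB.instance Definition _ :=
  PointedTopological.copy iso_quot (quotient_topology {eq_quot orbit_equiv}).
HB.instance Definition _ :=
  Quotient.copy iso_quot (quotient_topology {eq_quot orbit_equiv}).

(* The action [g [f] = [f \o g^-1]]; see [iso_actE]. *)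
Definition iso_act (g : G) (q : iso_quot) : iso_quot :=
  \pi_iso_quot (iso_comp (repr q) (ltrans S g^-1)).

Lemma iso_actE (g : G) (f : Iso S) :
  iso_act g (\pi f) = \pi_iso_quot (iso_comp f (ltrans S g^-1)).
Proof.
apply/eqquotP; have /eqquotP/asboolP[l Ll {2}->] := reprK (\pi_iso_quot f).
by apply/asboolP; exists l => //; apply: iso_inj.
Qed.

End IsoQuotient.

Definition borel (T : ptopologicalType) : Type := g_sigma_algebraType (@open T).
HB.instance Definition _ (T : ptopologicalType) :=
  Measurable.copy (borel T) (g_sigma_algebraType (@open T)).

Section Haar.
Variables (R : realType) (G : groupType) (S : set G).

(* Left Haar measure.  [Iso S] is locally compact and second countable when [S]
   is a generating system, so regularity of [mu] is automatic. *)
Definition haar_measure (mu : {measure set (borel (Iso S)) -> \bar R}) : Prop :=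
  [/\ forall (g : Iso S) (A : set (borel (Iso S))), measurable A ->
        mu [set iso_comp g f | f in A] = mu A,
      forall K : set (Iso S), compact K -> (mu K < +oo)%E &
      forall U : set (Iso S), open U -> U !=set0 -> (0 < mu U)%E].

Definition fundamental_domain (L : groupClosed G) (D : set (borel (Iso S))) :
    Prop :=
  measurable D /\
  forall q : iso_quot S L, exists! f : Iso S, D f /\ \pi_(iso_quot S L) f = q.

(* As [m] has total mass 1, the last clause forces [0 < mu D < +oo]. *)
Definition haar_probability (L : groupClosed G)
    (m : probability (borel (iso_quot S L)) R) : Prop :=
  exists (mu : {measure set (borel (Iso S)) -> \bar R})
         (D : set (borel (Iso S))),
    [/\ haar_measure mu, fundamental_domain L D &
        forall A : set (borel (iso_quot S L)), measurable A ->
          m A = (mu (D `&` \pi_(iso_quot S L) @^-1` A) / mu D)%E].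

End Haar.

Section ProductProbability.
Context d1 d2 (X : measurableType d1) (Y : measurableType d2) (R : realType).
Variables (mu : probability X R) (nu : probability Y R).

Definition product_probability : set (X * Y) -> \bar R := (mu \x nu)%E.

HB.instance Definition _ := Measure.copy product_probability (mu \x nu)%E.

Let product_probability_setT : product_probability [set: X * Y] = 1%E.
Proof.
rewrite /product_probability -setXTT product_measure1E//=.
by rewrite !probability_setT mule1.
Qed.

HB.instance Definition _ :=
  Measure_isProbability.Build _ _ _ product_probability
    product_probability_setT.
End ProductProbability.

(* [Y] is a Polish space and [phi] an isomorphism onto its Borel space. *)
Definition standard_borel (R : realType) d (X : measurableType d) : Prop :=
  exists (Y : completePseudoMetricType R) (phi : X -> Y),
    [/\ hausdorff_space Y, @second_countable Y, bijective phi &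
        forall B : set Y, <<s open >> B <-> measurable (phi @^-1` B)].

Section OrbitEquivalence.
Variables (R : realType) (G : groupType).

Definition pmp_action d (X : measurableType d) (mu : probability X R)
    (alpha : G -> X -> X) : Prop :=
  [/\ standard_borel R X,
      forall x, alpha 1 x = x,
      forall g h x, alpha (g * h) x = alpha g (alpha h x),
      forall g, measurable_fun setT (alpha g) &
      forall g A, measurable A -> mu (alpha g @^-1` A) = mu A].

Variable S : set G.

Definition schreier_adj (X : Type) (alpha : G -> X -> X) (x y : X) : Prop :=
  exists2 s, S s & alpha s x = y.

Definition invariant_set (X : Type) (alpha : G -> X -> X) (A : set X) : Prop :=
  forall g, alpha g @` A = A.

Definition isometric_orbit_equivalent
    d (X : measurableType d) (mu : probability X R) (alpha : G -> X -> X)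
    d' (Y : measurableType d') (nu : probability Y R) (beta : G -> Y -> Y) :
    Prop :=
  [/\ pmp_action mu alpha, pmp_action nu beta &
  exists (Phi : X -> Y) (Psi : Y -> X) (X0 : set X),
    [/\ cancel Phi Psi, cancel Psi Phi,
        measurable_fun setT Phi & measurable_fun setT Psi] /\
    [/\ forall B, measurable B -> mu (Phi @^-1` B) = nu B,
        [/\ measurable X0, mu X0 = 1%E & invariant_set alpha X0],
        invariant_set beta (Phi @` X0) &
        forall x x', X0 x -> X0 x' ->
          gdist (schreier_adj beta) (Phi x) (Phi x') =
          gdist (schreier_adj alpha) x x']].

Definition diagonal_act (X Y : Type) (alpha : G -> X -> X) (beta : G -> Y -> Y)
    (g : G) (p : X * Y) : X * Y := (alpha g p.1, beta g p.2).

End OrbitEquivalence.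

(* Main.v *)
Require Import Defs.
From HB Require Import structures.
From mathcomp Require Import all_boot all_order all_algebra.
From mathcomp Require Import finmap.
From mathcomp Require Import all_classical all_reals all_analysis.

(** Write [K] for the stabilizer of 1 in [Iso S].  Every isometry is uniquely
    [f = l k] with [l = f 1] acting by left translation and [k] in [K] (the
    isometry [rooted f]), so a class modulo [L] is described by [k] together
    with the coset [(f 1)^-1 L].  Acting by [g] turns [f] into [f g^-1], whose
    rooted part is [h k g^-1] with [h^-1 = k (g^-1)], and moves the coset to
    [h (f 1)^-1 L].  Thus the coset moves by [h], and not by [g].  Inverting
    the rooted part repairs this: the inverse of [h k g^-1] is
    [g k^-1 h^-1], which has the same class modulo [G] as [k^-1 h^-1], that is
    [h] applied to the class of [k^-1].  Hence
      [Phi [f] = ([k^-1], (f 1)^-1 L)]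
    satisfies [Phi (g q) = h (Phi q)] ([orbit_map_act]).  Since [k] is an
    isometry fixing 1, [g |-> h] is a bijection of [G] preserving [S], so [Phi]
    is an isomorphism between the graphs of the two actions, everywhere and
    not only almost everywhere ([orbit_map_adj]).

    That [Phi] carries one measure to the other rests on the unimodularity of
    [Iso S].  Two left invariant measures on [Iso S] that give the same finite
    mass to [K] are equal ([haar_unique]): [K] is cut by the image of a finite
    tuple into translates of the stabilizer of that tuple, all of the same
    measure, whose number does not depend on the measures compared.  All sets
    [{f | f x = y}] are fundamental domains of [G], hence have the same measure
    as [K]; so right translates and the inverse image of a Haar measure are
    again left invariant with the same mass on [K], and coincide with it
    ([right_invariant], [inv_invariant]).  Right invariance gives the
    invariance of the measures on the quotients, and invariance under inversion
    gives the measure of the sets [Phi^-1 (A x C)] ([orbit_map_rectangle]),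
    computed on the fundamental domain of [L] formed by the isometries whose
    value at 1 is the inverse of a chosen coset representative.

    The quotients are standard Borel spaces because a class is encoded by the
    sequence of values of [k] and [k^-1] and by its coset; recording [k^-1] as
    well makes the encoding complete, since a pointwise limit of bijections
    is bijective as soon as the inverses converge too. *)

Set Implicit Arguments.
Unset Strict Implicit.
Unset Printing Implicit Defensive.

Import Order.TTheory GRing.Theory Num.Theory.

Local Open Scope classical_set_scope.
Local Open Scope quotient_scope.
Local Open Scope ring_scope.
Local Open Scope group_scope.

(** * Polish topologies from sequence codes *)

Definition cylinder (X C : Type) (k : X -> nat -> C) (n : nat) (x : X) : set X :=
  [set y | forall i, (i < n)%N -> k y i = k x i].

Lemma cylinder_le (X C : Type) (k : X -> nat -> C) m n x :
  (m <= n)%N -> cylinder k n x `<=` cylinder k m x.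
Proof. by move=> mn y xy i im; apply: xy; exact: leq_trans mn. Qed.

Lemma cylinder_sym (X C : Type) (k : X -> nat -> C) n x y :
  cylinder k n x y -> cylinder k n y x.
Proof. by move=> xy i im; rewrite xy. Qed.

(** Completeness says that the image of the coding is closed in the space of
    sequences, for the topology of pointwise convergence. *)
Record complete_coding (X C : Type) := CompleteCoding {
  code :> X -> nat -> C;
  code_complete : forall u : nat -> C,
    (forall n, exists x, forall i, (i < n)%N -> code x i = u i) ->
    exists x, code x =1 u
}.

(** An alias of [X] that carries the ultrametric of common prefixes. *)
Definition coded (X C : Type) (k : complete_coding X C) : Type := X.

Section CodedMetric.
Variables (R : realType) (X : pointedType) (C : Type).
Variable k : complete_coding X C.
Local Open Scope ring_scope.

Definition coded_ball (x : X) (e : R) : set X :=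
  [set y | exists2 n : nat, n.+1%:R^-1 < e & cylinder k n x y].

Lemma coded_ball_center (x : X) (e : R) : 0 < e -> coded_ball x e x.
Proof.
move=> e0; exists (Num.truncn e^-1) => //.
by rewrite invf_plt ?posrE// truncnS_gt// invr_ge0 ltW.
Qed.

Lemma coded_ball_sym (x y : X) (e : R) : coded_ball x e y -> coded_ball y e x.
Proof. by case=> n ne xy; exists n => //; exact: cylinder_sym. Qed.

Lemma coded_ball_triangle (x y z : X) (e f : R) :
  coded_ball x e y -> coded_ball y f z -> coded_ball x (e + f) z.
Proof.
move=> [m me xy] [n nf yz]; exists (minn m n).
  have pos q (g : R) : q.+1%:R^-1 < g -> 0 < g by apply: lt_trans; rewrite invr_gt0.
  case: leqP => _; first by rewrite (lt_le_trans me)// lerDl ltW// (pos _ _ nf).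
  by rewrite (lt_le_trans nf)// lerDr ltW// (pos _ _ me).
move=> i; rewrite leq_min => /andP[im iN].
by rewrite (yz _ iN) (xy _ im).
Qed.
Local Close Scope ring_scope.

HB.instance Definition _ := Pointed.copy (coded k) X.
HB.instance Definition _ :=
  hasNbhs.Build (coded k) (nbhs_ (entourage_ coded_ball)).
HB.instance Definition _ := Nbhs_isPseudoMetric.Build R (coded k)
  erefl coded_ball_center coded_ball_sym coded_ball_triangle erefl.

Local Open Scope ring_scope.
Lemma coded_nbhsP (x : coded k) (A : set (coded k)) :
  nbhs x A <-> exists n, cylinder k n x `<=` A.
Proof.
rewrite -(@nbhs_ballE R); split.
  move=> [e /= e0 eA]; have [n ne _] := coded_ball_center x e0.
  by exists n => y xy; apply: eA; exists n.
move=> [n nA]; exists n.+1%:R^-1; first by rewrite /= invr_gt0.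
move=> y [m mn xy]; apply: nA; apply: cylinder_le xy.
by move: mn; rewrite ltf_pV2 ?posrE ?ltr0n// ltr_nat => /ltnW; rewrite ltnS.
Qed.

Lemma coded_cauchy_cvg (F : set_system (coded k)) :
  ProperFilter F -> cauchy F -> cvg F.
Proof.
move=> PF /cauchyP cF.
have {}cF n : exists x : coded k, F (cylinder k n x).
  have n0 : 0 < (n.+1%:R^-1 : R) by rewrite invr_gt0.
  have [x Fx] := cF _ n0; exists x; apply: filterS Fx => y [m mn xy].
  apply: cylinder_le xy.
  by move: mn; rewrite ltf_pV2 ?posrE ?ltr0n// ltr_nat => /ltnW; rewrite ltnS.
have [x Fx] := choice cF.
have Fxy i n : (i < n)%N -> k (x n) i = k (x i.+1) i.
  move=> iN; have [y [ny my]] := filter_ex (filterI (Fx n) (Fx i.+1)).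
  by rewrite -(ny _ iN) -(my i).
have [|y yE] := @code_complete _ _ k (fun i => k (x i.+1) i).
  by move=> n; exists (x n) => i; exact: Fxy.
apply/cvg_ex; exists (y : coded k) => A /coded_nbhsP[n nA].
apply: filterS (Fx n) => z xz; apply: nA => i iN.
by rewrite yE (xz _ iN) Fxy.
Qed.

HB.instance Definition _ :=
  Uniform_isComplete.Build (coded k) coded_cauchy_cvg.

End CodedMetric.

(** The ultrametric of common prefixes is complete, has countably many cylinders
    when the alphabet is countable, and by hypothesis induces the given
    topology; so the identity is a Borel isomorphism onto a Polish space. *)
Lemma standard_borel_coded (R : realType) (X : ptopologicalType)
    (C : countType) (k : complete_coding X C) :
  (forall x y, k x =1 k y -> x = y) ->
  (forall U : set X,
    open U <-> forall x, U x -> exists n, cylinder k n x `<=` U) ->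
  standard_borel R (borel X).
Proof.
move=> kI openP.
pose Y : completePseudoMetricType R := coded k.
have YopenP (U : set Y) : @open Y U <-> @open X U.
  rewrite openP openE /interior; split => h x /h.
    by move=> /coded_nbhsP.
  by move=> ?; apply/(coded_nbhsP R).
exists Y, id; split.
- move=> p q pq; apply: kI => i.
  have [||y [py qy]] := pq (cylinder k i.+1 p) (cylinder k i.+1 q).
  + by apply/(coded_nbhsP R); exists i.+1.
  + by apply/(coded_nbhsP R); exists i.+1.
  by rewrite -(py i)// (qy i).
- pose D (t : seq C) : set Y := [set y | mkseq (k y) (size t) = t].
  have DE n (x : Y) : D (mkseq (k x) n) = cylinder k n x.
    apply/seteqP; split => y; rewrite /D/cylinder/= size_mkseq; last first.
      by move=> xy; apply/eq_in_map => i; rewrite mem_iota => /xy.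
    by move=> /eq_in_map + i iN; apply; rewrite mem_iota.
  exists (range D).
    exact: sub_countable (card_image_le _ _) (countableP _).
  split.
    move=> _ [t _ <-]; apply/YopenP/openP => x; rewrite /D/= => Dx.
    by exists (size t); rewrite -DE Dx.
  move=> x A /coded_nbhsP[n nA]; exists (cylinder k n x) => //; split => //.
  by exists (mkseq (k x) n).
- by exists id.
- move=> B; rewrite preimage_id.
  suff -> : @open Y = @open X by [].
  by apply/funext => U; apply/propext.
Qed.

(** * The topology of the isometry group *)

Lemma measurable_preimage (d d' : measure_display) (T : measurableType d)
  (U : measurableType d') (phi : T -> U) A :
  measurable_fun setT phi -> measurable A -> measurable (phi @^-1` A).
Proof. by move=> mphi mA; rewrite -[_ @^-1` _]setTI; exact: mphi. Qed.

Lemma continuous_measurable_borel (T U : ptopologicalType) (phi : T -> U) :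
  continuous phi -> measurable_fun [set: borel T] (phi : borel T -> borel U).
Proof.
move=> /continuousP cphi.
apply: (@measurability _ _ (borel T) (borel U) setT phi (@open U) erefl).
move=> _ [A oA <-]; rewrite setTI. by apply: sub_sigma_algebra; exact: cphi.
Qed.

Lemma measurable_preimage_borel (T U : ptopologicalType) (phi : T -> U)
    (A : set (borel U)) :
  continuous phi -> measurable A -> measurable (phi @^-1` A : set (borel T)).
Proof.
move=> /continuous_measurable_borel mphi mA.
by rewrite -[X in measurable X]setTI; exact: mphi.
Qed.

Lemma open_measurable_borel (T : ptopologicalType) (A : set T) :
  open A -> measurable (A : set (borel T)).
Proof. by move=> oA; exact: sub_sigma_algebra. Qed.

Section Isometries.
Variables (G : groupType) (S : set G).
Implicit Types (f g h : Iso S) (x y : G).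

Lemma iso_fun_inj f : injective (iso_fun f).
Proof. by have [/bij_inj fI _] := iso_funP f. Qed.

Lemma iso_fun_surj f y : exists x, iso_fun f x = y.
Proof. by have [[e _ eK] _] := iso_funP f; exists (e y). Qed.

Definition inv_fun f y : G := xget 1 [set x | iso_fun f x = y].

Lemma inv_funK f : cancel (inv_fun f) (iso_fun f).
Proof. by move=> y; exact: xgetPex (iso_fun_surj f y). Qed.

Lemma iso_funK f : cancel (iso_fun f) (inv_fun f).
Proof. by move=> x; apply: (@iso_fun_inj f); rewrite inv_funK. Qed.

Lemma iso_inv_subproof f :
  (inv_fun f : {ptws G -> discrete_topology G}) \in isometries S.
Proof.
rewrite inE; split.
  by exists (iso_fun f); [exact: inv_funK|exact: iso_funK].
by move=> x y; have [_ <-] := iso_funP f; rewrite !inv_funK.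
Qed.

Definition iso_inv f : Iso S :=
  exist (fun k => k \in isometries S) _ (iso_inv_subproof f).

Lemma iso_invKx f x : iso_fun f (iso_fun (iso_inv f) x) = x.
Proof. exact: inv_funK. Qed.

Lemma iso_invxK f x : iso_fun (iso_inv f) (iso_fun f x) = x.
Proof. exact: iso_funK. Qed.

Lemma iso_inv_eq f x y : (iso_fun (iso_inv f) y = x) <-> (iso_fun f x = y).
Proof. by split=> <-; rewrite ?iso_invKx ?iso_invxK. Qed.

Lemma iso_compA f g h : iso_comp f (iso_comp g h) = iso_comp (iso_comp f g) h.
Proof. exact: iso_inj. Qed.

Lemma iso_invK f : iso_inv (iso_inv f) = f.
Proof. by apply: iso_inj => x; apply/iso_inv_eq; rewrite iso_invxK. Qed.

Lemma iso_invM f g : iso_inv (iso_comp f g) = iso_comp (iso_inv g) (iso_inv f).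
Proof.
by apply: iso_inj => x; apply/iso_inv_eq; rewrite !iso_compE !iso_invKx.
Qed.

Lemma iso_inv_ltrans x : iso_inv (ltrans S x) = ltrans S x^-1.
Proof. by apply: iso_inj => y; apply/iso_inv_eq; rewrite !ltransE mulVKg. Qed.

Lemma ltransM x y : ltrans S (x * y) = iso_comp (ltrans S x) (ltrans S y).
Proof. by apply: iso_inj => z; rewrite iso_compE !ltransE mulgA. Qed.

Lemma iso_compK f : cancel (iso_comp f) (iso_comp (iso_inv f)).
Proof. by move=> g; apply: iso_inj => x; rewrite !iso_compE iso_invxK. Qed.

Lemma iso_compVK f : cancel (iso_comp (iso_inv f)) (iso_comp f).
Proof. by move=> g; apply: iso_inj => x; rewrite !iso_compE iso_invKx. Qed.

Definition agree (F : seq G) f : set (Iso S) :=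
  [set g | {in F, iso_fun g =1 iso_fun f}].

(** [G] being discrete, the sets of isometries that agree with a given one on a
    finite set form a base of the topology. *)
Lemma open_IsoP (U : set (Iso S)) :
  open U <-> forall f, U f -> exists F, agree F f `<=` U.
Proof.
split.
  move=> [V oV <-] f Vf.
  (* The finite agreement sets around [f] generate a filter converging to [f]
     pointwise, so every open set containing [f] contains one of them. *)
  pose A (F : seq G) : set {ptws G -> discrete_topology G} :=
    [set g | forall x, x \in F -> g x = iso_fun f x].
  have FF : Filter (filter_from [set: seq G] A).
    apply: filter_from_filter; first by exists [::].
    move=> E F _ _; exists (E ++ F) => // g EF.
    by split=> x xF; apply: EF; rewrite mem_cat xF ?orbT.
  have cF : {ptws, filter_from [set: seq G] A -->
      (iso_fun f : G -> discrete_topology G)}.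
    apply/(@pointwise_cvgP (discrete_topology G) (discrete_topology G)) => x.
    move=> B /principal_filterP Bx; exists [:: x] => // g gx.
    by rewrite /= gx// inE.
  have [F _ FV] := cF _ (open_nbhs_nbhs (conj oV Vf)).
  by exists F => g gF; apply: FV.
move=> h; rewrite openE => f /h[F FU]; rewrite /interior.
apply: filterS FU _; elim: F => [|x F IH].
  by apply: filterS filterT => g _ x.
have xf : nbhs f [set g | iso_fun g x = iso_fun f x].
  have cf : continuous (fun g : Iso S => (iso_fun g x : discrete_topology G)).
    move=> g; apply: (@continuous_comp (Iso S) {ptws G -> discrete_topology G}
      (discrete_topology G) set_val (fun u => u x) g).
      exact: initial_continuous.
    exact: (@proj_continuous G (fun=> discrete_topology G) x).
  exact: (cf f _ (discrete_set1 (iso_fun f x : discrete_topology G))).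
apply: filterS (filterI xf IH) => g [gx gF] y.
by rewrite inE => /predU1P[->//|/gF].
Qed.

Lemma continuous_Iso (phi : Iso S -> Iso S) :
  (forall f x, exists F, forall g, agree F f g ->
    iso_fun (phi g) x = iso_fun (phi f) x) ->
  continuous phi.
Proof.
move=> h; apply/continuousP => U /open_IsoP oU.
apply/open_IsoP => f /oU[E EU].
have [F Fh] := choice (h f).
exists (flatten (map F E)) => g gF; apply: EU => x xE; apply: Fh => y yF.
by apply: gF; apply/flatten_mapP; exists x.
Qed.

Lemma iso_compl_continuous f : continuous (iso_comp f : Iso S -> Iso S).
Proof.
apply: continuous_Iso => g x; exists [:: x] => h hx.
by rewrite !iso_compE hx// inE.
Qed.

Lemma iso_compr_continuous f : continuous (fun g : Iso S => iso_comp g f).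
Proof.
apply: continuous_Iso => g x; exists [:: iso_fun f x] => h hx.
by rewrite !iso_compE hx// inE.
Qed.

(** The value of [f^-1] at [x] is [y] on the open set [{f | f y = x}]. *)
Lemma iso_inv_continuous : continuous (iso_inv : Iso S -> Iso S).
Proof.
apply: continuous_Iso => f x; exists [:: inv_fun f x] => g gf.
by apply/iso_inv_eq; rewrite gf ?inE//; exact: iso_invKx.
Qed.

(** The factor of [f] in the stabilizer of 1. *)
Definition rooted f : Iso S := iso_comp (ltrans S (iso_fun f 1)^-1) f.

Lemma rootedE f x : iso_fun (rooted f) x = (iso_fun f 1)^-1 * iso_fun f x.
Proof. by []. Qed.

Lemma rooted1 f : iso_fun (rooted f) 1 = 1.
Proof. by rewrite rootedE mulVg. Qed.

Lemma rootedK f : iso_comp (ltrans S (iso_fun f 1)) (rooted f) = f.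
Proof. by apply: iso_inj => x; rewrite iso_compE ltransE rootedE mulVKg. Qed.

Lemma rooted_ltrans x f : rooted (iso_comp (ltrans S x) f) = rooted f.
Proof.
apply: iso_inj => y; rewrite !rootedE !iso_compE !ltransE.
by rewrite invgM -mulgA mulKg.
Qed.

Lemma rooted_id f : iso_fun f 1 = 1 -> rooted f = f.
Proof. by move=> f1; apply: iso_inj => x; rewrite rootedE f1 invg1 mul1g. Qed.

Lemma rooted_continuous : continuous (rooted : Iso S -> Iso S).
Proof.
apply: continuous_Iso => f x; exists [:: 1; x] => g gf.
by rewrite !rootedE !gf// !inE eqxx ?orbT.
Qed.

End Isometries.

Section Countable.
Variables (G : groupType) (S : set G).

(** * Finitely generated groups are countable *)

Definition word_value (s : seq G) (w : seq nat) : G :=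
  foldr (fun i x => nth 1 s i * x) 1 w.

Lemma word_value_cat s v w :
  word_value s (v ++ w) = word_value s v * word_value s w.
Proof. by elim: v => [|i v IH] /=; rewrite ?mul1g// IH mulgA. Qed.

Section Words.
Variable s : seq G.
Hypothesis sV : {in s, forall x, x^-1 \in s}.

Definition word_pred : {pred G} := fun x => `[< exists w, word_value s w = x >].

Let word1 : 1 \in word_pred.
Proof. by apply/asboolP; exists [::]. Qed.

Let wordM : mulg_closed word_pred.
Proof.
move=> x y /asboolP[v <-] /asboolP[w <-]; apply/asboolP; exists (v ++ w).
exact: word_value_cat.
Qed.

Let wordV : invg_closed word_pred.
Proof.
move=> _ /asboolP[w <-]; apply/asboolP; elim: w => [|i w [v vE]] /=.
  by exists [::]; rewrite invg1.
have [si|si] := ltnP i (size s); last by exists v; rewrite nth_default// mul1g.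
exists (v ++ [:: index (nth 1 s i)^-1 s]).
by rewrite word_value_cat/= mulg1 nth_index ?vE ?invgM// sV// mem_nth.
Qed.

HB.instance Definition _ := isInvClosed.Build _ word_pred wordV.
HB.instance Definition _ := isMulClosed.Build _ word_pred wordM.
HB.instance Definition _ := monoid.isMul1Closed.Build _ word_pred word1.

Definition word_group : groupClosed G := GroupClosed.clone G word_pred _.

End Words.

(** Words in the generators form a subgroup, hence exhaust [G].  Countability is
    given as an injective code with a left inverse, which serves below to
    enumerate [G] and finite sequences of its elements. *)
Lemma generating_system_countable :
  generating_system S -> exists (c : G -> nat) (e : nat -> G), cancel c e.
Proof.
move=> [/finite_seqP[s ->] _ sV gen].
have {}sV : {in s, forall x, x^-1 \in s} by move=> x; exact: sV.
have words x : exists w, word_value s w = x.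
  apply/asboolP; apply: (gen (word_group sV)) => y ys; apply/asboolP.
  by exists [:: index y s]; rewrite /= mulg1 nth_index.
have [c cK] := choice words.
pose e n := word_value s (odflt [::] (choice.unpickle n)).
by exists (fun x => choice.pickle (c x)), e => x; rewrite /e choice.pickleK cK.
Qed.

End Countable.

(** * Invariant measures on the isometry group *)

Section Quotient.
Variables (G : groupType) (S : set G) (L : groupClosed G).

Lemma iso_quotP (f g : Iso S) : \pi_(iso_quot S L) f = \pi g <->
  exists2 l, l \in L & g = iso_comp (ltrans S l) f.
Proof.
split; first by move/eqquotP/asboolP.
by move=> h; apply/eqquotP/asboolP.
Qed.

Lemma pi_ltrans l (f : Iso S) : l \in L ->
  \pi_(iso_quot S L) (iso_comp (ltrans S l) f) = \pi f.
Proof. by move=> lL; apply/esym/iso_quotP; exists l. Qed.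

End Quotient.

Definition left_invariant (R : realType) (G : groupType) (S : set G)
    (mu : {measure set (borel (Iso S)) -> \bar R}) : Prop :=
  forall (g : Iso S) (A : set (borel (Iso S))), measurable A ->
    mu (iso_comp g @^-1` A) = mu A.

Lemma ltrans_comp_inj (G : groupType) (S : set G) x y (f : Iso S) :
  iso_comp (ltrans S x) f = iso_comp (ltrans S y) f -> x = y.
Proof.
move=> /(congr1 (fun g => iso_fun g (iso_fun (iso_inv f) 1))).
by rewrite !iso_compE iso_invKx !ltransE !mulg1.
Qed.

Section Measures.
Variables (R : realType) (G : groupType) (S : set G).
Local Notation IS := (borel (Iso S)).
Implicit Types (mu nu : {measure set IS -> \bar R}) (L : groupClosed G).

Lemma measurable_iso_compl (g : Iso S) (A : set IS) :
  measurable A -> measurable (iso_comp g @^-1` A : set IS).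
Proof. exact: measurable_preimage_borel (@iso_compl_continuous _ _ g). Qed.

Lemma measurable_iso_compr (g : Iso S) :
  measurable_fun [set: IS] (fun f : IS => iso_comp f g : IS).
Proof. exact: (continuous_measurable_borel (@iso_compr_continuous _ _ g)). Qed.

Lemma measurable_iso_inv : measurable_fun [set: IS] (@iso_inv G S : IS -> IS).
Proof. exact: (continuous_measurable_borel (@iso_inv_continuous _ _)). Qed.

Lemma measurable_fiber x y : measurable ([set f | iso_fun f x = y] : set IS).
Proof.
apply: (@open_measurable_borel (Iso S)); apply/open_IsoP => f /= <-.
by exists [:: x] => g; apply; rewrite inE.
Qed.

Variables (c : G -> nat) (e : nat -> G).
Hypothesis eK : cancel c e.

(** The translate of [D'] by [l^-1], for [l] in [L], meets [D] in the points that
    [l] moves into [D']; these pieces partition [D].  The elements of [L] are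
    enumerated by an arbitrary [l] so that the lemma can be used both for an
    enumeration and for its inverses. *)
Lemma fundamental_domain_decomp mu L (D D' E : set IS) (P : set nat)
    (l : nat -> G) :
  fundamental_domain L D -> fundamental_domain L D' -> measurable E ->
  (forall n, P n -> l n \in L) ->
  (forall x, x \in L -> exists2 n, P n & l n = x) ->
  (forall n m, P n -> P m -> l n = l m -> n = m) ->
  mu (D `&` E) =
  (\sum_(n <oo | n \in P) mu (D `&` E `&` iso_comp (ltrans S (l n)) @^-1` D'))%E.
Proof.
move=> [mD _] [mD' fdD'] mE PL LP lI.
rewrite -measure_bigcup; last 2 first.
- move=> n _; apply: measurableI; first exact: measurableI.
  exact: measurable_iso_compl.
- move=> n m Pn Pm [f [[_ /= nD'] [_ /= mD'f]]].
  have [h [_ huniq]] := fdD' (\pi f).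
  apply: lI => //; apply: (@ltrans_comp_inj _ S _ _ f).
  rewrite -(huniq (iso_comp (ltrans S (l n)) f)).
    by rewrite -(huniq (iso_comp (ltrans S (l m)) f))// pi_ltrans//; exact: PL.
  by rewrite pi_ltrans//; exact: PL.
congr (mu _); apply/seteqP; split => [f [Df Ef]|f [n _ [[Df Ef] _]]] //.
have [h [[D'h /esym/iso_quotP[x xL hE]] _]] := fdD' (\pi f).
have [n Pn nx] := LP _ xL.
by exists n => //; split => //=; rewrite nx -hE.
Qed.

(** The pieces into which [D'] cuts [D] are translates of the pieces into which
    [D] cuts [D']. *)
Lemma fundamental_domain_indep mu L (D D' E : set IS) :
  left_invariant mu ->
  fundamental_domain L D -> fundamental_domain L D' -> measurable E ->
  (forall l, l \in L -> iso_comp (ltrans S l) @^-1` E = E) ->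
  mu (D `&` E) = mu (D' `&` E).
Proof.
move=> muL fdD fdD' mE EL.
pose P := [set n | e n \in L /\ c (e n) = n].
(* [e] need not be injective; [P] keeps one index for each element of [L]. *)
have PI n m : P n -> P m -> e n = e m -> n = m.
  by move=> [_ {2}<-] [_ {2}<-] ->.
have LP x : x \in L -> exists2 n, P n & e n = x.
  by move=> xL; exists (c x); rewrite /P/= eK.
have PL n : P n -> e n \in L by case.
rewrite (@fundamental_domain_decomp mu L D D' E P e)//.
rewrite (@fundamental_domain_decomp mu L D' D E P (fun n => (e n)^-1))//.
- apply: eq_eseriesr => n; rewrite inE => Pn.
  rewrite -(muL (ltrans S (e n)^-1)); last first.
    have [mD _] := fdD; have [mD' _] := fdD'.
    apply: measurableI; first exact: measurableI.
    exact: measurable_iso_compl.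
  rewrite !preimage_setI -[X in _ `&` _ `&` X]comp_preimage.
  have -> : iso_comp (ltrans S (e n)) \o iso_comp (ltrans S (e n)^-1) = id.
    apply/funext => f; rewrite /= iso_compA -ltransM mulgV.
    by apply: iso_inj => x; rewrite iso_compE ltransE mul1g.
  rewrite EL ?gpredV ?PL// preimage_id; congr (mu _).
  by rewrite setIC setIA setIAC.
- by move=> n /PL; rewrite gpredV.
- move=> x xL; have [|n Pn nx] := LP x^-1; first by rewrite gpredV.
  by exists n => //; rewrite nx invgK.
- by move=> n m Pn Pm /invg_inj; exact: PI.
Qed.

Definition stab1 : set IS := [set f | iso_fun f 1 = 1].

Lemma fiber_fundamental x y :
  fundamental_domain (whole G) ([set f | iso_fun f x = y] : set IS).
Proof.
split; first exact: measurable_fiber.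
move=> q; pose f := repr q; pose l := y * (iso_fun f x)^-1.
exists (iso_comp (ltrans S l) f); split.
  by split; rewrite /= ?pi_ltrans// ?reprK// iso_compE ltransE mulgVK.
move=> g [gxy gq].
have /esym/iso_quotP[k _ gE] : \pi_(iso_quot S (whole G)) g = \pi f.
  by rewrite gq reprK.
rewrite gE; congr (iso_comp (ltrans S _) _).
by rewrite /l -gxy gE iso_compE ltransE mulgK.
Qed.

(** This is where unimodularity comes from: [{f | f x = y}] is a right translate
    of the stabilizer of 1 up to a left translation, and both are fundamental
    domains of [G]. *)
Lemma fiber_measure mu x y : left_invariant mu ->
  mu [set f | iso_fun f x = y] = mu stab1.
Proof.
move=> muL; rewrite -[LHS]/(mu _) -[X in mu X]setIT -[in RHS](setIT stab1).
by apply: (@fundamental_domain_indep mu (whole G)) => //;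
  exact: fiber_fundamental.
Qed.

Definition seq_fiber (x y : seq G) : set IS := [set f | map (iso_fun f) x = y].

Lemma seq_fiber_cat x x' y y' : size y = size x ->
  seq_fiber (x ++ x') (y ++ y') = seq_fiber x y `&` seq_fiber x' y'.
Proof.
move=> xy; apply/seteqP; split => f; rewrite /seq_fiber/= map_cat.
  by move/eqP; rewrite eqseq_cat ?size_map// => /andP[/eqP ? /eqP].
by move=> [<- <-].
Qed.

Lemma measurable_seq_fiber x y : measurable (seq_fiber x y).
Proof.
apply: (@open_measurable_borel (Iso S)); apply/open_IsoP => f /= <-.
exists x => g gf; rewrite /seq_fiber/=.
exact/eq_in_map.
Qed.

Lemma seq_fiber_measure mu x (f : Iso S) : left_invariant mu ->
  mu (seq_fiber x (map (iso_fun f) x)) = mu (seq_fiber x x).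
Proof.
move=> muL; rewrite -(muL f); last exact: measurable_seq_fiber.
congr (mu _); apply/seteqP; split => g; rewrite /seq_fiber/=; last first.
  move=> gx; rewrite -[in RHS]gx -map_comp.
  by apply: eq_map.
have -> : map (iso_fun (iso_comp f g)) x = map (iso_fun f) (map (iso_fun g) x).
  by rewrite -map_comp; apply: eq_map.
exact/inj_map/iso_fun_inj.
Qed.

(** The isometries fixing 1, sorted by the image of the tuple [x]; the image is
    encoded by a natural number so that the classes form a sequence. *)
Definition stab1_class (x : seq G) (n : nat) : set IS :=
  [set f | stab1 f /\ choice.pickle (map c (map (iso_fun f) x)) = n].

Lemma stab1_classE x (f : Iso S) : stab1 f ->
  stab1_class x (choice.pickle (map c (map (iso_fun f) x))) =
  seq_fiber (1 :: x) (map (iso_fun f) (1 :: x)).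
Proof.
rewrite /stab1/= => f1; apply/seteqP; split => g.
  move=> [/= g1 /(pcan_inj choice.pickleK) /(inj_map (can_inj eK))].
  by rewrite /seq_fiber/= g1 f1 => ->.
by rewrite /seq_fiber/= => -[g1 gx]; rewrite /stab1_class/stab1/= gx g1.
Qed.

(** Each nonempty class is a left translate of the pointwise stabilizer of
    [1 :: x].  Which classes are nonempty does not depend on [mu]. *)
Lemma stab1_decomp mu x : left_invariant mu ->
  mu stab1 = (\sum_(n <oo) mu (seq_fiber (1%g :: x) (1%g :: x)) *
    (`[< stab1_class x n !=set0 >]%:R)%:E)%E.
Proof.
move=> muL.
have clsE n : mu (stab1_class x n) = (mu (seq_fiber (1%g :: x) (1%g :: x)) *
    (`[< stab1_class x n !=set0 >]%:R)%:E)%E /\ measurable (stab1_class x n).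
  case: asboolP => [[f [f1 fn]]|/set0P/negP/negPn/eqP ->]; last first.
    by rewrite measure0 mule0.
  rewrite mule1 -fn stab1_classE// seq_fiber_measure//; split => //.
  exact: measurable_seq_fiber.
rewrite -(eq_eseriesr (fun n _ => (clsE n).1)).
rewrite -measure_semi_bigcup.
- congr (mu _); apply/seteqP; split => [f f1|f [n _ []]//].
  by exists (choice.pickle (map c (map (iso_fun f) x))).
- by move=> n; have [] := clsE n.
- by move=> m n _ _ [f [[_ <-] [_ <-]]].
- by apply: bigcupT_measurable => n; have [] := clsE n.
Qed.

(** If [N] is the number of nonempty classes, then the measure of the stabilizer
    is the mass of [stab1] divided by [N].  As [N] may be infinite in the
    extended reals, the proof compares instead
    [nu Z * mu stab1 = nu Z * mu Z * N = mu Z * nu stab1]. *)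
Lemma stab_measure_uniq mu nu x : left_invariant mu -> left_invariant nu ->
  mu stab1 = nu stab1 -> (mu stab1 < +oo)%E ->
  mu (seq_fiber (1 :: x) (1 :: x)) = nu (seq_fiber (1 :: x) (1 :: x)).
Proof.
move=> muL nuL munu muoo.
set Z := seq_fiber _ _.
have mZ : measurable Z by exact: measurable_seq_fiber.
have ms : measurable stab1 by exact: measurable_fiber.
have Zs : Z `<=` stab1 by move=> f [].
have muZ : (mu Z <= mu stab1)%E by rewrite le_measure ?inE.
have nuZ : (nu Z <= mu stab1)%E by rewrite munu le_measure ?inE.
have muf : mu stab1 \is a fin_num by rewrite ge0_fin_numE.
have mZf : mu Z \is a fin_num by rewrite ge0_fin_numE// (le_lt_trans muZ).
have nZf : nu Z \is a fin_num by rewrite ge0_fin_numE// (le_lt_trans nuZ).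
have : (nu Z * mu stab1 = mu Z * mu stab1)%E.
  rewrite {2}munu (stab1_decomp x muL) (stab1_decomp x nuL) -/Z.
  rewrite -(fineK mZf) -(fineK nZf) -!nneseriesZl//.
  by apply: eq_eseriesr => n _; rewrite muleCA.
have [s0|s0] := eqVneq (mu stab1) 0%E.
  move=> _; move: muZ nuZ; rewrite s0 !measure_le0 => /eqP -> /eqP ->.
  by [].
rewrite -(fineK mZf) -(fineK nZf) -(fineK muf) -!EFinM => -[/mulIf ->]//.
by rewrite fine_eq0.
Qed.

(** The sets of isometries with prescribed values on a tuple containing 1 form a
    pi-system that generates the Borel sets, and each of them is empty or a left
    translate of the stabilizer of the tuple. *)
Lemma haar_unique mu nu : left_invariant mu -> left_invariant nu ->
  mu stab1 = nu stab1 -> (mu stab1 < +oo)%E ->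
  forall A, measurable A -> mu A = nu A.
Proof.
move=> muL nuL munu muoo.
pose C : set (set IS) :=
  [set A | exists x y, size y = (size x).+1 /\ A = seq_fiber (1%g :: x) y].
apply: (measure_unique C (fun n => seq_fiber [:: 1] [:: e n])).
- apply/seteqP; split.
    apply: smallest_sub; first exact: smallest_sigma_algebra.
    move=> U /open_IsoP oU.
    (* An open set is the countable union of the cylinders that it contains. *)
    pose W (p : seq nat * seq nat) : set IS :=
      [set f | [/\ size p.2 = (size p.1).+1,
        seq_fiber (1 :: map e p.1) (map e p.2) `<=` U &
        seq_fiber (1 :: map e p.1) (map e p.2) f]].
    have -> : U = \bigcup_p W p.
      apply/seteqP; split => [f Uf|f [p _ [_ pU /pU]]//].
      have [x xU] := oU _ Uf.
      have ceK y : map e (map c y) = y.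
        by rewrite -map_comp map_id_in// => z _; exact: eK.
      exists (map c x, map c (map (iso_fun f) (1 :: x))) => //.
      rewrite /W/= !ceK eK; split => //; first by rewrite !size_map.
      by move=> g [_ gx]; apply: xU; exact/eq_in_map.
    apply: (@countable_bigcupT_measurable _ (g_sigma_algebraType C)) => //.
    move=> p.
    have [[ps pU]|np] := pselect (size p.2 = (size p.1).+1 /\
        seq_fiber (1 :: map e p.1) (map e p.2) `<=` U).
      have -> : W p = seq_fiber (1 :: map e p.1) (map e p.2).
        by apply/seteqP; split => [f []//|f fp]; split.
      apply: sub_sigma_algebra; exists (map e p.1), (map e p.2).
      by rewrite !size_map.
    have -> : W p = set0 by apply/seteqP; split => [f [ps pU _]|//]; case: np.
    exact: measurable0.
  apply: smallest_sub; first exact: smallest_sigma_algebra.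
  by move=> _ [x [y [_ ->]]]; exact: measurable_seq_fiber.
- move=> _ _ [x [y [xy ->]]] [x' [y' [xy' ->]]].
  exists (x ++ 1 :: x'), (y ++ y'); split.
    by rewrite !size_cat/= xy xy' addSn addnS.
  by rewrite -seq_fiber_cat.
- by move=> n; exists [::], [:: e n].
- apply/seteqP; split => // f _; exists (c (iso_fun f 1)) => //.
  by rewrite /seq_fiber/= eK.
- move=> _ [x [y [_ ->]]].
  have [->|/set0P[f <-]] := eqVneq (seq_fiber (1 :: x) y) set0.
    by rewrite !measure0.
  by rewrite !seq_fiber_measure//; exact: stab_measure_uniq.
- move=> n; rewrite (_ : seq_fiber _ _ = [set f | iso_fun f 1 = e n]).
    by rewrite fiber_measure.
  by apply/seteqP; split => f; rewrite /seq_fiber/=; [case|move=> ->].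
Qed.

(** The right translate of [mu] is left invariant, and gives [stab1] the mass
    that [mu] gives to the set of isometries sending some point to 1. *)
Lemma right_invariant mu g (A : set IS) :
  left_invariant mu -> (mu stab1 < +oo)%E -> measurable A ->
  mu ((fun f => iso_comp f g) @^-1` A) = mu A.
Proof.
move=> muL muoo mA.
pose nu : {measure set IS -> \bar R} :=
  measure_function_pushforward__canonical__measure_function_Measure mu
    (measurable_iso_compr g).
have nuE B : nu B = mu ((fun f => iso_comp f g) @^-1` B) by [].
have mr (B : set IS) : measurable B ->
    measurable ((fun f : IS => iso_comp f g : IS) @^-1` B).
  exact: (measurable_preimage_borel (@iso_compr_continuous _ _ g)).
apply/esym; rewrite -nuE; apply: haar_unique => //.
  move=> h B mB; rewrite !nuE -(muL h _ (mr _ mB)).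
  by congr (mu _); apply/seteqP; split => f; rewrite /= iso_compA.
by rewrite nuE -(fiber_measure (iso_fun g 1) 1 muL).
Qed.

(** The image of [mu] by inversion is left invariant because [mu] is right
    invariant, and [stab1] is its own inverse. *)
Lemma inv_invariant mu (A : set IS) :
  left_invariant mu -> (mu stab1 < +oo)%E -> measurable A ->
  mu (@iso_inv G S @^-1` A) = mu A.
Proof.
move=> muL muoo mA.
pose nu : {measure set IS -> \bar R} :=
  measure_function_pushforward__canonical__measure_function_Measure mu
    measurable_iso_inv.
have nuE B : nu B = mu (@iso_inv G S @^-1` B) by [].
have mi (B : set IS) : measurable B -> measurable (@iso_inv G S @^-1` B : set IS).
  exact: (measurable_preimage_borel (@iso_inv_continuous _ _)).
apply/esym; rewrite -nuE; apply: haar_unique => //.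
  move=> h B mB; rewrite !nuE.
  rewrite -[RHS](right_invariant (iso_inv h) muL muoo (mi _ mB)).
  by congr (mu _); apply/seteqP; split => f; rewrite /= iso_invM iso_invK.
rewrite nuE; congr (mu _).
by apply/seteqP; split => f; rewrite /stab1/= => f1; apply/iso_inv_eq.
Qed.

End Measures.

(** * Coordinates on the quotients *)

Section QuotientCoordinates.
Variables (G : groupType) (S : set G) (L : groupClosed G).
Local Notation Q := (iso_quot S L).
Implicit Types (f h : Iso S) (q : Q) (t : cosets L).

Lemma cosetP x y : \pi_(cosets L) x = \pi y <-> x^-1 * y \in L.
Proof. by split => [/eqquotP//|h]; apply/eqquotP. Qed.

(** Left multiplication of [f] by [L] changes [f 1] within a right coset of [L],
    so the left coset of [(f 1)^-1] depends only on the class of [f]. *)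
Definition iso_coset f : cosets L := \pi_(cosets L) (iso_fun f 1)^-1.

Lemma iso_coset_ltrans l f : l \in L ->
  iso_coset (iso_comp (ltrans S l) f) = iso_coset f.
Proof.
move=> lL; apply/cosetP.
by rewrite invgK iso_compE ltransE mulgK.
Qed.

Definition quot_rooted q : Iso S := rooted (repr q).
Definition quot_coset q : cosets L := iso_coset (repr q).

Lemma quot_rooted_pi f : quot_rooted (\pi_Q f) = rooted f.
Proof.
have /iso_quotP[l lL {2}->] := reprK (\pi_Q f).
by rewrite rooted_ltrans.
Qed.

Lemma quot_coset_pi f : quot_coset (\pi_Q f) = iso_coset f.
Proof.
have /iso_quotP[l lL {2}->] := reprK (\pi_Q f).
by rewrite iso_coset_ltrans.
Qed.

Lemma quot_rooted1 q : iso_fun (quot_rooted q) 1 = 1.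
Proof. exact: rooted1. Qed.

(** For [h] fixing 1, an isometry with rooted part [h] and coset [t]. *)
Definition coset_rep t h : Iso S := iso_comp (ltrans S (repr t)^-1) h.

Lemma iso_coset_rep t h : iso_fun h 1 = 1 -> iso_coset (coset_rep t h) = t.
Proof.
by move=> h1; rewrite /iso_coset iso_compE h1 ltransE mulg1 invgK reprK.
Qed.

Lemma coset_rep_rooted f :
  \pi_Q (coset_rep (iso_coset f) (rooted f)) = \pi f.
Proof.
apply/esym/iso_quotP.
exists ((repr (iso_coset f))^-1 * (iso_fun f 1)^-1); last first.
  by rewrite /coset_rep /rooted ltransM iso_compA.
by apply/cosetP; rewrite reprK.
Qed.

Lemma quot_coset_repK q : \pi_Q (coset_rep (quot_coset q) (quot_rooted q)) = q.
Proof. by rewrite coset_rep_rooted reprK. Qed.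

Lemma quot_rooted_rep t h : iso_fun h 1 = 1 ->
  quot_rooted (\pi_Q (coset_rep t h)) = h.
Proof. by move=> h1; rewrite quot_rooted_pi rooted_ltrans rooted_id. Qed.

Lemma quot_coset_rep t h : iso_fun h 1 = 1 ->
  quot_coset (\pi_Q (coset_rep t h)) = t.
Proof. by move=> h1; rewrite quot_coset_pi iso_coset_rep. Qed.

Lemma continuous_from_quot (U : topologicalType) (phi : Q -> U) :
  continuous (fun f : Iso S => phi (\pi_Q f)) -> continuous phi.
Proof.
move=> /continuousP cphi; apply/continuousP => A oA.
exact: (cphi _ oA).
Qed.

Lemma pi_quot_continuous : continuous (\pi_Q : Iso S -> Q).
Proof. by apply/continuousP => A; exact. Qed.

Lemma iso_act_continuous g : continuous (@iso_act G S L g : Q -> Q).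
Proof.
apply: continuous_from_quot.
under eq_fun do rewrite iso_actE.
move=> f; apply: (@continuous_comp (Iso S) (Iso S) Q).
  exact: iso_compr_continuous.
exact: pi_quot_continuous.
Qed.

Variables (c : G -> nat) (e : nat -> G).
Hypothesis eK : cancel c e.

(** The component [iso_inv] is there for completeness: a limit of isometries
    fixing 1 is surjective because their inverses converge as well. *)
Definition quot_code q (i : nat) : nat * nat * nat :=
  (c (repr (quot_coset q)), c (iso_fun (quot_rooted q) (e i)),
    c (iso_fun (iso_inv (quot_rooted q)) (e i))).

Lemma quot_codeP q q' y i : e i = y -> quot_code q i = quot_code q' i <->
  [/\ quot_coset q = quot_coset q',
    iso_fun (quot_rooted q) y = iso_fun (quot_rooted q') y &
    iso_fun (iso_inv (quot_rooted q)) y = iso_fun (iso_inv (quot_rooted q')) y].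
Proof.
move=> <-; split; last by rewrite /quot_code => -[-> -> ->].
move=> [/(can_inj eK) tt /(can_inj eK) -> /(can_inj eK) ->]; split=> //.
by rewrite -[LHS]reprK tt reprK.
Qed.

Lemma quot_code_inj q q' : quot_code q =1 quot_code q' -> q = q'.
Proof.
move=> qq'; have key y := (@quot_codeP q q' _ _ (eK y)).1 (qq' _).
rewrite -(quot_coset_repK q) -(quot_coset_repK q').
have [-> _ _] := key 1; congr (\pi_Q (coset_rep _ _)).
by apply: iso_inj => y; have [] := key y.
Qed.

(** On every finite set the sequence [u] is the code of an actual class, which is
    enough to check that the limits [a] and [b] are inverse isometries. *)
Lemma quot_code_complete (u : nat -> nat * nat * nat) :
  (forall n, exists q, forall i, (i < n)%N -> quot_code q i = u i) ->
  exists q, quot_code q =1 u.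
Proof.
move=> approx.
have {}approx (J : seq nat) : exists q, forall i, i \in J -> quot_code q i = u i.
  have [q qu] := approx (\max_(i <- J) i).+1; exists q => i iJ; apply: qu.
  by rewrite ltnS; exact: leq_bigmax_seq.
have [q0 q0u] := approx [:: 0%N].
pose t := quot_coset q0.
pose a y := e (u (c y)).1.2; pose b y := e (u (c y)).2.
have ab (F : seq G) : exists h : Iso S, iso_fun h 1 = 1 /\
    forall y, y \in F -> iso_fun h y = a y /\ iso_fun (iso_inv h) y = b y.
  have [q qu] := approx (map c F); exists (quot_rooted q).
  split=> [|y yF]; first exact: quot_rooted1.
  by rewrite /a /b -qu ?map_f// /quot_code/= !eK.
have aK : cancel a b.
  move=> y; have [h [_ hab]] := ab [:: y; a y].
  have [hy _] := hab y (mem_head _ _).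
  have [|_ <-] := hab (a y); first by rewrite !inE eqxx orbT.
  by rewrite -hy iso_invxK.
have bK : cancel b a.
  move=> y; have [h [_ hab]] := ab [:: y; b y].
  have [_ hy] := hab y (mem_head _ _).
  have [|<- _] := hab (b y); first by rewrite !inE eqxx orbT.
  by rewrite -hy iso_invKx.
have aI : (a : {ptws G -> discrete_topology G}) \in isometries S.
  rewrite inE; split=> [|y z]; first by exists b.
  have [h [_ hab]] := ab [:: y; z].
  have [<- _] := hab y (mem_head _ _).
  have [|<- _] := hab z; first by rewrite !inE eqxx orbT.
  by have [_ ->] := iso_funP h.
pose h : Iso S := exist (fun k => k \in isometries S) _ aI.
have h1 : iso_fun h 1 = 1.
  have [h' [h'1 hab]] := ab [:: 1].
  by have [] := hab 1 (mem_head _ _); rewrite h'1.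
exists (\pi_Q (coset_rep t h)) => i.
(* The index [i] need not be the code [c (e i)] of the element [e i], but the
   entries of a code at both indices are the same. *)
have [q qu] := approx [:: 0%N; i; c (e i)].
have qi : quot_code q i = u (c (e i)).
  by rewrite -qu ?inE ?eqxx ?orbT// /quot_code eK.
have -> : u i = quot_code q i by rewrite qu// !inE eqxx orbT.
apply/(@quot_codeP _ _ (e i)) => //.
rewrite quot_coset_rep// quot_rooted_rep//; split.
- have [] // := (@quot_codeP q0 q (e 0%N) 0%N erefl).1.
  by rewrite q0u ?qu ?inE.
- by rewrite -[LHS]/(a (e i)) /a -qi /= eK.
- apply/iso_inv_eq; rewrite -[LHS]/(a _).
  have <- : b (e i) = iso_fun (iso_inv (quot_rooted q)) (e i).
    by rewrite /b -qi /= eK.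
  exact: bK.
Qed.

Lemma quot_openP (U : set Q) :
  open U <-> forall q, U q -> exists n, cylinder quot_code n q `<=` U.
Proof.
split=> [/(@open_IsoP G S) oU q Uq|h].
  have [|F FU] := oU (coset_rep (quot_coset q) (quot_rooted q)).
    by rewrite /= quot_coset_repK.
  exists (\max_(y <- 1 :: F) c y).+1 => q' qq'.
  rewrite -(quot_coset_repK q'); apply: FU => y yF.
  have key z : z \in 1 :: F -> quot_code q' (c z) = quot_code q (c z).
    by move=> zF; apply: qq'; rewrite ltnS (leq_bigmax_seq (F := c)).
  have /(quot_codeP _ _ (eK _))[-> _ _] := key _ (mem_head _ _).
  have yF1 : y \in 1 :: F by rewrite inE yF orbT.
  have /(quot_codeP _ _ (eK _))[_ + _] := key _ yF1.
  by rewrite !iso_compE => ->.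
apply/(@open_IsoP G S) => f /h[n nU].
pose E := map e (iota 0 n).
exists (1 :: E ++ map (iso_fun (iso_inv (rooted f))) E) => g gf.
apply: nU => i iN; have iE : e i \in E by rewrite map_f// mem_iota.
have rg y : y \in E ++ map (iso_fun (iso_inv (rooted f))) E ->
    iso_fun (rooted g) y = iso_fun (rooted f) y.
  by move=> yE; rewrite !rootedE !gf// inE ?eqxx// yE orbT.
apply/(@quot_codeP _ _ (e i)) => //; rewrite !quot_rooted_pi !quot_coset_pi.
split.
- by rewrite /iso_coset gf// inE eqxx.
- by rewrite rg// mem_cat iE.
- apply/iso_inv_eq; rewrite rg; first exact: iso_invKx.
  by rewrite mem_cat map_f ?orbT.
Qed.

Lemma standard_borel_iso_quot (R : realType) : standard_borel R (borel Q).
Proof.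
apply: (@standard_borel_coded R _ _ (CompleteCoding quot_code_complete)).
  exact: quot_code_inj.
exact: quot_openP.
Qed.

End QuotientCoordinates.

(** * Haar probability measures on the quotients *)

Section HaarQuotient.
Variables (R : realType) (G : groupType) (S : set G).
Local Notation IS := (borel (Iso S)).
Implicit Types (mu nu : {measure set IS -> \bar R}) (L : groupClosed G).

Lemma measurable_preimage_pi L (A : set (borel (iso_quot S L))) :
  measurable A -> measurable (\pi_(iso_quot S L) @^-1` A : set IS).
Proof. exact: (measurable_preimage_borel (@pi_quot_continuous _ _ _)). Qed.

Variables (c : G -> nat) (e : nat -> G).
Hypothesis eK : cancel c e.

Definition coset_section L : set IS :=
  [set f | iso_fun f 1 = (repr (iso_coset L f))^-1].

Lemma coset_sectionE L (C : set (cosets L)) :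
  coset_section L `&` (@iso_coset G S L @^-1` C) =
  \bigcup_(t in C) [set f : IS | iso_fun f 1 = (repr t)^-1].
Proof.
apply/seteqP; split=> [f [sf Cf]|f [t Ct /= ft]]; first by exists (iso_coset L f).
have ct : iso_coset L f = t by rewrite /iso_coset ft invgK reprK.
by split; rewrite /coset_section/= ct.
Qed.

Lemma coset_section_fundamental L : finite_index L ->
  fundamental_domain L (coset_section L).
Proof.
move=> finL; split.
  rewrite -[coset_section L]setIT -(preimage_setT (@iso_coset G S L)).
  rewrite coset_sectionE; apply: fin_bigcup_measurable => // t _.
  exact: measurable_fiber.
move=> q; exists (coset_rep (quot_coset q) (quot_rooted q)); split.
  split; last exact: quot_coset_repK.
  rewrite /coset_section/= iso_coset_rep ?quot_rooted1//.
  by rewrite iso_compE ltransE quot_rooted1 mulg1.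
move=> f [/= fs <-]; rewrite quot_rooted_pi quot_coset_pi.
by rewrite /coset_rep -fs rootedK.
Qed.

(** Over each coset [t] the set is a left translate, by the inverse of the
    representative of [t], of the part of [B] fixing 1. *)
Lemma coset_section_measure mu L (C : set (cosets L)) (B : set IS) :
  finite_index L -> left_invariant mu -> measurable B ->
  mu (coset_section L `&`
      [set f | C (iso_coset L f) /\ B (rooted f)]) =
  (counting C * mu (@stab1 G S `&` B))%E.
Proof.
move=> finL muL mB.
have finC : finite_set C by apply: sub_finite_set finL.
have -> : coset_section L `&` [set f | C (iso_coset L f) /\ B (rooted f)] =
    \bigcup_(t in C) (iso_comp (ltrans S (repr t)) @^-1` (@stab1 G S `&` B)).
  apply/seteqP; split=> [f [sf [Cf Bf]]|f [t Ct [/= ft Bt]]].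
    exists (iso_coset L f) => //.
    have lf : iso_comp (ltrans S (repr (iso_coset L f))) f = rooted f.
      by rewrite /rooted sf invgK.
    by split; rewrite /= lf// /stab1/= rooted1.
  have ft1 : iso_fun f 1 = (repr t)^-1.
    by apply: (@mulgI _ (repr t)); rewrite mulgV; exact: ft.
  have ct : iso_coset L f = t by rewrite /iso_coset ft1 invgK reprK.
  split; rewrite /coset_section/= ct//; split=> //.
  by rewrite /rooted ft1 invgK.
have ms : measurable (@stab1 G S) by exact: measurable_fiber.
rewrite measure_fin_bigcup//; last 2 first.
- move=> t s Ct Cs [f [[/= ft _] [/= fs _]]].
  rewrite -[t]reprK -[s]reprK; congr \pi.
  apply: (@mulIg _ (iso_fun f 1)).
  by move: ft fs; rewrite /stab1/= !iso_compE !ltransE => -> ->.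
- by move=> t _; apply: measurable_iso_compl; exact: measurableI.
rewrite (eq_fsbigr (fun=> mu (@stab1 G S `&` B)))//; last first.
  by move=> t _; apply: muL; exact: measurableI.
rewrite /counting asboolT// fsbig_finite//= big_const_seq count_predT.
elim: (size _) => [|n IHn]; first by rewrite mul0e.
by rewrite iterS IHn -natr1 EFinD ge0_muleDl ?lee_fin// mul1e addeC.
Qed.

Lemma fundamental_domain_compr L (D : set IS) (g : Iso S) :
  fundamental_domain L D ->
  fundamental_domain L ((fun f => iso_comp f g) @^-1` D).
Proof.
move=> [mD fdD]; split.
  exact: (measurable_preimage_borel (@iso_compr_continuous _ _ g)).
move=> q; have [h [[Dh hq] huniq]] :=
  fdD (\pi_(iso_quot S L) (iso_comp (repr q) g)).
have gK f : iso_comp (iso_comp f g) (iso_inv g) = f.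
  by apply: iso_inj => x; rewrite !iso_compE iso_invKx.
have gVK f : iso_comp (iso_comp f (iso_inv g)) g = f.
  by apply: iso_inj => x; rewrite !iso_compE iso_invxK.
exists (iso_comp h (iso_inv g)); split.
  split; first by rewrite /= gVK.
  have /esym/iso_quotP[l lL ->] := hq.
  by rewrite iso_compA gK pi_ltrans// reprK.
move=> f [/= Dfg fq]; rewrite (huniq (iso_comp f g)) ?gK//; split=> //.
have /esym/iso_quotP[l lL ->] : \pi_(iso_quot S L) f = \pi_(iso_quot S L) (repr q).
  by rewrite fq reprK.
by rewrite -iso_compA pi_ltrans.
Qed.

Lemma haar_measure_left_invariant mu : haar_measure mu -> left_invariant mu.
Proof.
move=> [muL _ _] g A mA; rewrite -(muL (iso_inv g) A mA); congr (mu _).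
apply/seteqP; split => [f gf|_ [f Af <-]] /=; last by rewrite iso_compVK.
by exists (iso_comp g f) => //; rewrite iso_compK.
Qed.

(** Left invariance makes the formula for [m] independent of the fundamental
    domain.  The total mass 1 of [m] forces [mu D < +oo], and [coset_section L]
    contains a translate of the open set [stab1], so [mu] can be normalized to
    have mass 1 there. *)
Lemma haar_probabilityP L (m : probability (borel (iso_quot S L)) R) :
  finite_index L -> haar_probability m ->
  exists mu, [/\ left_invariant mu, mu (@stab1 G S) = 1%E &
    forall D (A : set (borel (iso_quot S L))),
      fundamental_domain L D -> measurable A ->
      m A = (mu (D `&` \pi_(iso_quot S L) @^-1` A) / mu D)%E].
Proof.
move=> finL [mu [D0 [hmu fdD0 mE]]].
have muL := haar_measure_left_invariant hmu.
have indep D (A : set (borel (iso_quot S L))) :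
    fundamental_domain L D -> measurable A ->
    mu (D `&` \pi_(iso_quot S L) @^-1` A) =
    mu (D0 `&` \pi_(iso_quot S L) @^-1` A).
  move=> fdD mA; apply: (fundamental_domain_indep eK muL fdD fdD0).
    exact: measurable_preimage_pi.
  by move=> l lL; apply/seteqP; split=> f; rewrite /= pi_ltrans.
have indepT D : fundamental_domain L D -> mu D = mu D0.
  by move=> fdD; have := indep D _ fdD measurableT; rewrite preimage_setT !setIT.
have D01 : (mu D0 / mu D0 = 1)%E.
  have := mE _ measurableT; rewrite preimage_setT setIT => <-.
  exact: probability_setT.
have D0oo : (mu D0 < +oo)%E.
  rewrite ltey; apply/eqP => D0y; move: D01; rewrite D0y invey mule0.
  by move/eqP; rewrite eq_sym onee_eq0.
have sle : (mu (@stab1 G S) <= mu D0)%E.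
  pose t : cosets L := \pi 1.
  rewrite -(indepT _ (coset_section_fundamental finL)).
  rewrite -(fiber_measure eK 1 (repr t)^-1 muL).
  rewrite le_measure ?inE//.
  - exact: measurable_fiber.
  - by have [] := coset_section_fundamental finL.
  move=> f /= ft; rewrite /coset_section/=.
  by rewrite /iso_coset ft invgK reprK.
have soo : (mu (@stab1 G S) < +oo)%E by exact: le_lt_trans D0oo.
have s0 : (0 < mu (@stab1 G S))%E.
  have [_ _] := hmu; apply.
    apply/open_IsoP => f f1; exists [:: 1] => g gf.
    by rewrite /stab1/= gf ?inE.
  by exists (ltrans S 1); rewrite /stab1/= ltransE mulg1.
pose r := (fine (mu (@stab1 G S)))^-1%R.
have sf : mu (@stab1 G S) \is a fin_num by rewrite ge0_fin_numE.
have fs0 : (0 < fine (mu (@stab1 G S)))%R by rewrite fine_gt0// s0.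
have r0 : (0 <= r)%R by rewrite invr_ge0 ltW.
exists (mscale (NngNum r0) mu); split.
- by move=> g A mA; rewrite /= /mscale/= muL.
- by rewrite /= /mscale/= -(fineK sf) -EFinM mulVf// gt_eqF.
- move=> D A fdD mA; rewrite mE//= /mscale/= (indep D)// (indepT D)//.
  have D0f : mu D0 \is a fin_num by rewrite ge0_fin_numE.
  have If : mu (D0 `&` \pi_(iso_quot S L) @^-1` A) \is a fin_num.
    rewrite ge0_fin_numE// (le_lt_trans _ D0oo)// le_measure ?inE//.
      by apply: measurableI; [case: fdD0|exact: measurable_preimage_pi].
    by case: fdD0.
  rewrite -(fineK D0f) -(fineK If) -!EFinM !inver.
  have r_neq0 : r != 0%R by rewrite gt_eqF// invr_gt0.
  have d_neq0 : fine (mu D0) != 0%R.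
    by rewrite gt_eqF// fine_gt0// D0oo andbT (lt_le_trans s0).
  rewrite mulf_eq0 (negbTE r_neq0) (negbTE d_neq0) -!EFinM; congr EFin.
  by rewrite invfM mulrACA divff// mul1r.
Qed.

(** Right translation by [g] carries a fundamental domain of [L] to another one
    and preserves [mu]. *)
Lemma haar_probability_invariant L (m : probability (borel (iso_quot S L)) R)
    g (A : set (borel (iso_quot S L))) :
  finite_index L -> haar_probability m -> measurable A ->
  m (@iso_act G S L g @^-1` A) = m A.
Proof.
move=> finL hm mA; have [mu [muL mu1 mE]] := haar_probabilityP finL hm.
have mu1oo : (mu (@stab1 G S) < +oo)%E by rewrite mu1 ltry.
pose D := coset_section L.
have fdD : fundamental_domain L D := coset_section_fundamental finL.
have [mD _] := fdD.
pose h := ltrans S g^-1.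
have hV f : iso_comp (iso_comp f h) (ltrans S g) = f.
  by apply: iso_inj => x; rewrite !iso_compE !ltransE mulKg.
pose D' : set IS := (fun f => iso_comp f (ltrans S g)) @^-1` D.
have fdD' : fundamental_domain L D' by exact: fundamental_domain_compr.
have [mD' _] := fdD'.
have DE : D = (fun f => iso_comp f h) @^-1` D'.
  by apply/seteqP; split => f; rewrite /D'/= hV.
rewrite (mE D)//; last first.
  exact: (measurable_preimage_borel (@iso_act_continuous _ _ _ _)).
rewrite (mE D')//; congr (_ / _)%E; last first.
  by rewrite DE (right_invariant eK).
rewrite -[RHS](right_invariant eK h muL mu1oo); last first.
  by apply: measurableI => //; exact: measurable_preimage_pi.
rewrite preimage_setI -DE; congr (mu (_ `&` _)).
by apply/seteqP; split => f; rewrite /= iso_actE.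
Qed.

End HaarQuotient.

(** * The orbit map *)

Lemma gdist_iso (T U : Type) (E : T -> T -> Prop) (F : U -> U -> Prop)
    (phi : T -> U) (psi : U -> T) :
  cancel phi psi -> cancel psi phi ->
  (forall x y, F (phi x) (phi y) <-> E x y) ->
  forall x y, gdist F (phi x) (phi y) = gdist E x y.
Proof.
move=> phiK psiK FE x y.
pose H (P : pred nat) : \bar nat :=
  if pselect (exists n, P n) is left h then EFin (ex_minn h) else +oo%E.
rewrite -[LHS]/(H (fun n => `[< walk _ n _ _ >])).
rewrite -[RHS]/(H (fun n => `[< walk _ n _ _ >])).
congr H; apply/funext => n; apply: asbool_equiv_eq.
elim: n x => [|n IHn] x /=; first by split=> [/(can_inj phiK)|->].
split=> [[z Fz wz]|[z Ez wz]].
  exists (psi z); first by apply/FE; rewrite psiK.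
  by apply/IHn; rewrite psiK.
by exists (phi z); [exact/FE|exact/IHn].
Qed.

Lemma standard_borel_iso (R : realType) d d' (X : measurableType d)
    (Y : measurableType d') (f : X -> Y) (g : Y -> X) :
  cancel f g -> cancel g f -> measurable_fun setT f -> measurable_fun setT g ->
  standard_borel R X -> standard_borel R Y.
Proof.
move=> fK gK mf mg [Z [phi [hZ sZ bphi borelE]]].
exists Z, (phi \o g); split=> //; first by apply: bij_comp => //; exists f.
move=> B; rewrite borelE comp_preimage; split=> [|mB].
  exact: measurable_preimage.
rewrite (_ : phi @^-1` B = f @^-1` (g @^-1` (phi @^-1` B))).
  exact: measurable_preimage.
by apply/seteqP; split => x; rewrite /= fK.
Qed.

Section RootedGenerators.
Variables (G : groupType) (S : set G).
Hypothesis S1 : ~ S 1.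

Lemma gdist_eq1 x : gdist (cayley_adj S) 1 x = 1%:E <-> S x.
Proof.
rewrite /gdist; split.
  case: pselect => // h [].
  case: ex_minnP => n /asboolP wn _ n1; move: wn; rewrite n1 /=.
  by move=> [z [s Ss ->] <-]; rewrite mul1g.
move=> Sx; have w1 : walk (cayley_adj S) 1 1 x.
  by exists x => //; exists x; rewrite ?mul1g.
case: pselect => [h|[]]; last by exists 1%N; exact/asboolP.
congr EFin; case: ex_minnP => -[/asboolP /= x1|n _ /(_ 1%N)].
  by case: S1; rewrite x1.
by move=> /(_ (asboolT w1)); case: n.
Qed.

(** The generators are the elements at distance 1 from 1. *)
Lemma iso_generators (h : Iso S) x :
  iso_fun h 1 = 1 -> S (iso_fun h x) <-> S x.
Proof.
move=> h1; have [_ hd] := iso_funP h.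
by rewrite -!gdist_eq1 -[in X in X <-> _]h1 hd.
Qed.

End RootedGenerators.

Section CosetUnif.
Variables (R : realType) (G : groupType) (L : groupClosed G).
Hypothesis finL : finite_index L.

Lemma coset_actK (g : G) :
  cancel (@coset_act G L g) (@coset_act G L g^-1).
Proof.
by move=> t; rewrite -[t]reprK !coset_actE mulKg.
Qed.

Lemma coset_unifE (C : set (cosets L)) :
  coset_unif L R C = (counting C / counting [set: cosets L])%E.
Proof.
have cT : @counting (cosets L) R setT =
    (#|` fset_set [set: cosets L] |%fset%:R)%:E.
  by rewrite /counting asboolT.
rewrite /coset_unif /= /mnormalize /= !cT eqe /= orbF inver.
case: ifPn => // n0.
exfalso; move: n0; rewrite pnatr_eq0 cardfs_eq0.
move=> /eqP/(congr1 (fun A => point \in A)).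
rewrite in_fset_set// [LHS]mem_set// => /esym; rewrite in_fset0.
Qed.

Lemma coset_unif_invariant g (C : set (cosets L)) :
  coset_unif L R (@coset_act G L g @^-1` C) = coset_unif L R C.
Proof.
rewrite !coset_unifE; congr (_ / _)%E.
have finC (A : set (cosets L)) : finite_set A by exact: sub_finite_set finL.
rewrite /counting !asboolT//; congr (_%:R%:E).
have CE : @coset_act G L g @` (@coset_act G L g @^-1` C) = C.
  rewrite image_preimage//; apply/seteqP; split=> // t _.
  exists (coset_act g^-1 t) => //.
  by rewrite -[in RHS](coset_actK g^-1 t) invgK.
rewrite -[in RHS]CE fset_set_image// card_imfset//=.
exact: can_inj (coset_actK g).
Qed.

End CosetUnif.

Section ActionLaws.
Variables (G : groupType) (S : set G) (L : groupClosed G).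

Lemma iso_act1 (q : iso_quot S L) : iso_act 1 q = q.
Proof.
rewrite -[q]reprK iso_actE; congr (\pi_(iso_quot S L) _).
by apply: iso_inj => x; rewrite iso_compE ltransE invg1 mul1g.
Qed.

Lemma iso_actM g h (q : iso_quot S L) :
  iso_act (g * h) q = iso_act g (iso_act h q).
Proof.
rewrite -[q]reprK [iso_act h _]iso_actE !iso_actE; congr (\pi_(iso_quot S L) _).
by apply: iso_inj => x; rewrite !iso_compE !ltransE invgM mulgA.
Qed.

Lemma coset_act1 (t : cosets L) : coset_act 1 t = t.
Proof. by rewrite -[t]reprK coset_actE mul1g. Qed.

Lemma coset_actM g h (t : cosets L) :
  coset_act (g * h) t = coset_act g (coset_act h t).
Proof. by rewrite -[t]reprK !coset_actE mulgA. Qed.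

End ActionLaws.

Section OrbitMap.
Variables (G : groupType) (S : set G) (L : groupClosed G).
Local Notation QL := (iso_quot S L).
Local Notation QG := (iso_quot S (whole G)).

(** The action of [g] multiplies the rooted part by [g^-1] on the right and by the
    cocycle on the left; modulo [G] only a right factor matters.  Inversion
    therefore makes the cocycle, which moves the coset, act here as well. *)
Definition invert_rooted (q : QL) : QG := \pi_QG (iso_inv (quot_rooted q)).

Definition orbit_map (q : QL) : QG * cosets L :=
  (invert_rooted q, quot_coset q).

Definition orbit_inv (p : QG * cosets L) : QL :=
  \pi_QL (coset_rep p.2 (iso_inv (quot_rooted p.1))).

Lemma iso_inv1 (h : Iso S) : iso_fun h 1 = 1 -> iso_fun (iso_inv h) 1 = 1.
Proof. by move=> h1; apply/iso_inv_eq. Qed.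

Lemma orbit_mapK : cancel orbit_map orbit_inv.
Proof.
move=> q; rewrite /orbit_inv /orbit_map/= /invert_rooted quot_rooted_pi.
by rewrite rooted_id ?iso_invK ?quot_coset_repK// iso_inv1// quot_rooted1.
Qed.

Lemma orbit_invK : cancel orbit_inv orbit_map.
Proof.
move=> [q t]; rewrite /orbit_inv /orbit_map /invert_rooted/=.
have h1 : iso_fun (iso_inv (quot_rooted q)) 1 = 1.
  by rewrite iso_inv1// quot_rooted1.
rewrite quot_rooted_rep// quot_coset_rep// iso_invK; congr pair.
by rewrite /quot_rooted /rooted pi_ltrans// reprK.
Qed.

(** With [k] the rooted part of [q], the rooted part of [g q] is [h k g^-1] for
    [h = (k g^-1)^-1], because it has to fix 1. *)
Lemma orbit_map_act g q : orbit_map (iso_act g q) =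
  diagonal_act (@iso_act G S (whole G)) (@coset_act G L)
    (iso_fun (quot_rooted q) g^-1)^-1 (orbit_map q).
Proof.
set h := (_^-1 in RHS); pose f := repr q.
have hE : h = (iso_fun f g^-1)^-1 * iso_fun f 1.
  by rewrite /h rootedE invgM invgK.
rewrite -{1}[q]reprK iso_actE /orbit_map /diagonal_act/=; congr pair.
  rewrite /invert_rooted iso_actE quot_rooted_pi.
  have -> : rooted (iso_comp f (ltrans S g^-1)) =
      iso_comp (ltrans S h) (iso_comp (quot_rooted q) (ltrans S g^-1)).
    apply: iso_inj => x.
    by rewrite /quot_rooted rootedE !iso_compE !ltransE mulg1 hE -mulgA mulVKg.
  by rewrite !iso_invM !iso_inv_ltrans invgK -iso_compA pi_ltrans.
rewrite quot_coset_pi /quot_coset /iso_coset coset_actE.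
by rewrite iso_compE ltransE mulg1 hE mulgK.
Qed.

(** As [k] fixes 1 and preserves distances, [h] is a generator exactly when [g]
    is, and every [h] comes from some [g] because [k] is onto. *)
Lemma orbit_map_adj q q' : generating_system S ->
  schreier_adj S (diagonal_act (@iso_act G S (whole G)) (@coset_act G L))
    (orbit_map q) (orbit_map q') <->
  schreier_adj S (@iso_act G S L) q q'.
Proof.
move=> [_ S1 SV _]; have gen := iso_generators S1 _ (quot_rooted1 q).
split=> [[s Ss sq]|[s Ss <-]].
  exists (iso_fun (iso_inv (quot_rooted q)) s^-1)^-1.
    by apply: (SV); apply/gen; rewrite iso_invKx; exact: SV.
  apply: (can_inj orbit_mapK).
  by rewrite orbit_map_act invgK iso_invKx invgK sq.
exists (iso_fun (quot_rooted q) s^-1)^-1; last by rewrite orbit_map_act.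
by apply: (SV); apply/gen; exact: SV.
Qed.

Lemma invert_rooted_continuous : continuous invert_rooted.
Proof.
apply: continuous_from_quot; rewrite /invert_rooted.
under eq_fun do rewrite quot_rooted_pi.
move=> f; apply: (@continuous_comp (Iso S) (Iso S) QG).
  apply: (@continuous_comp (Iso S) (Iso S) (Iso S)).
    exact: rooted_continuous.
  exact: iso_inv_continuous.
exact: pi_quot_continuous.
Qed.

Lemma measurable_quot_coset :
  measurable_fun setT (@quot_coset G S L : borel QL -> cosets L).
Proof.
move=> _ C _; rewrite setTI; apply: (@open_measurable_borel QL).
apply/(@open_IsoP G S) => f fC; exists [:: 1] => g gf.
by move: fC; rewrite /= !quot_coset_pi /iso_coset gf ?inE.
Qed.

Lemma orbit_inv_continuous (t : cosets L) :
  continuous (fun q : QG => orbit_inv (q, t)).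
Proof.
apply: continuous_from_quot; rewrite /orbit_inv/=.
under eq_fun do rewrite quot_rooted_pi.
move=> f; apply: (@continuous_comp (Iso S) (Iso S) QL); last first.
  exact: pi_quot_continuous.
apply: (@continuous_comp (Iso S) (Iso S) (Iso S)); last first.
  exact: iso_compl_continuous.
apply: (@continuous_comp (Iso S) (Iso S) (Iso S)).
  exact: rooted_continuous.
exact: iso_inv_continuous.
Qed.

End OrbitMap.

(** * Orbit equivalence with a product *)

Section ProductTarget.
Variable R : realType.
Context d d1 d2 (Z : measurableType d) (X : measurableType d1)
  (Y : measurableType d2).
Variables (mX : probability X R) (mY : probability Y R).
Variables (inv : X * Y -> Z).

Lemma measurable_product_map (f : X -> X) (g : Y -> Y) :
  measurable_fun setT f -> measurable_fun setT g ->
  measurable_fun setT (fun p : X * Y => (f p.1, g p.2)).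
Proof.
move=> mf mg; apply: measurable_fun_pair.
  exact: (measurableT_comp mf measurable_fst).
exact: (measurableT_comp mg measurable_snd).
Qed.

Lemma product_probability_unique (m : {measure set (X * Y) -> \bar R}) :
  (forall A B, measurable A -> measurable B -> m (A `*` B) = (mX A * mY B)%E) ->
  forall A, measurable A -> m A = product_probability mX mY A.
Proof.
move=> mE A mA; apply/esym.
exact: (@product_measure_unique _ _ X Y R mX mY m mE A mA).
Qed.

Lemma product_probability_rectangle A B : measurable A -> measurable B ->
  product_probability mX mY (A `*` B) = (mX A * mY B)%E.
Proof. by move=> mA mB; exact: product_measure1E. Qed.

Lemma product_probability_invariant (f : X -> X) (g : Y -> Y) :
  measurable_fun setT f -> measurable_fun setT g ->
  (forall A, measurable A -> mX (f @^-1` A) = mX A) ->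
  (forall B, measurable B -> mY (g @^-1` B) = mY B) ->
  forall A, measurable A ->
  product_probability mX mY ((fun p => (f p.1, g p.2)) @^-1` A) =
  product_probability mX mY A.
Proof.
move=> mf mg fmu gnu A mA.
pose pm : {measure set (X * Y) -> \bar R} :=
  measure_function_pushforward__canonical__measure_function_Measure
    (product_probability mX mY) (measurable_product_map mf mg).
apply: (product_probability_unique (m := pm)) => // B C mB mC.
transitivity (product_probability mX mY ((f @^-1` B) `*` (g @^-1` C))).
  by [].
rewrite product_probability_rectangle ?fmu ?gnu//; exact: measurable_preimage.
Qed.

(** The second factor is finite and discrete, so measurability can be checked on
    each slice. *)
Lemma measurable_of_fibers : finite_set [set: Y] ->
  (forall B : set Y, measurable B) ->
  (forall y, measurable_fun setT (fun x => inv (x, y))) ->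
  measurable_fun setT inv.
Proof.
move=> finY mY_ minv _ A mA; rewrite setTI.
have -> : inv @^-1` A =
    \bigcup_(y in [set: Y]) (((fun x => inv (x, y)) @^-1` A) `*` [set y]).
  by apply/seteqP; split => [[x y] Ax|[x y] [z _ [/= Ax ->]]//]; exists y.
apply: fin_bigcup_measurable => // y _; apply: measurableX => //.
exact: (measurable_preimage (minv y)).
Qed.

End ProductTarget.

Lemma pmp_action_borel (R : realType) (G : groupType) (T : ptopologicalType)
    (mu : probability (borel T) R) (alpha : G -> T -> T) :
  standard_borel R (borel T) ->
  (forall x, alpha 1 x = x) ->
  (forall g h x, alpha (g * h) x = alpha g (alpha h x)) ->
  (forall g, continuous (alpha g)) ->
  (forall g (A : set (borel T)), measurable A -> mu (alpha g @^-1` A) = mu A) ->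
  pmp_action mu alpha.
Proof.
by move=> sT a1 aM ca amu; split=> // g; exact: continuous_measurable_borel.
Qed.

Section BorelProductTarget.
Variables (R : realType) (G : groupType) (S : set G).
Context d (Z X : ptopologicalType) (Y : measurableType d).
Variables (mu : probability (borel Z) R) (mX : probability (borel X) R).
Variables (mY : probability Y R).
Variables (alpha : G -> Z -> Z) (beta : G -> X -> X) (gamma : G -> Y -> Y).
Variables (f1 : Z -> X) (f2 : Z -> Y) (inv : X * Y -> Z).

Let phi z := (f1 z, f2 z).

(** A measurable isomorphism of the graphs of the two actions is an isometric
    orbit equivalence once its distribution is right on rectangles.  It holds on
    the whole space, and the product is a standard Borel space because [Z] is. *)
Lemma isometric_orbit_equivalent_product :
  finite_set [set: Y] -> (forall B : set Y, measurable B) ->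
  pmp_action mu alpha -> pmp_action mX beta ->
  (forall y, gamma 1 y = y) ->
  (forall g h y, gamma (g * h) y = gamma g (gamma h y)) ->
  (forall g B, mY (gamma g @^-1` B) = mY B) ->
  continuous f1 -> measurable_fun [set: borel Z] f2 ->
  (forall y, continuous (fun x => inv (x, y))) ->
  cancel phi inv -> cancel inv phi ->
  (forall (A : set (borel X)) B, measurable A ->
    mu (f1 @^-1` A `&` f2 @^-1` B) = (mX A * mY B)%E) ->
  (forall z z', schreier_adj S (diagonal_act beta gamma) (phi z) (phi z') <->
    schreier_adj S alpha z z') ->
  isometric_orbit_equivalent S mu alpha
    (product_probability mX mY) (diagonal_act beta gamma).
Proof.
move=> finY mY_ pmpa pmpb c1 cM cmu cf1 mf2 cinv phiK invK muE adjE.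
have mf1 : measurable_fun [set: borel Z] (f1 : borel Z -> borel X).
  exact: continuous_measurable_borel.
have mphi : measurable_fun [set: borel Z] (phi : borel Z -> borel X * Y).
  exact: measurable_fun_pair.
have minv : measurable_fun [set: borel X * Y] (inv : borel X * Y -> borel Z).
  by apply: measurable_of_fibers => // y; exact: continuous_measurable_borel.
have [sbZ _ _ _ _] := pmpa.
have [_ b1 bM mb bmu] := pmpb.
have mc g : measurable_fun setT (gamma g) by [].
split=> //.
  split.
  - exact: (@standard_borel_iso R _ _ (borel Z) (borel X * Y)%type phi inv phiK
      invK mphi minv sbZ).
  - by move=> [x y]; rewrite /diagonal_act/= b1 c1.
  - by move=> g h [x y]; rewrite /diagonal_act/= bM cM.
  - by move=> g; exact: measurable_product_map.
  - move=> g A mA.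
    exact: (product_probability_invariant (mb g) (mc g) (bmu g)
      (fun B _ => cmu g B) mA).
exists phi, inv, setT; split=> //; split.
- pose pm : {measure set (borel X * Y) -> \bar R} :=
    measure_function_pushforward__canonical__measure_function_Measure mu mphi.
  apply: (product_probability_unique (m := pm)) => A B mA _.
  exact: muE.
- split=> //; first exact: probability_setT.
  move=> g; apply/seteqP; split=> // z _; exists (alpha g^-1 z) => //.
  by have [_ a1 aM _ _] := pmpa; rewrite -aM mulgV a1.
- have -> : phi @` setT = setT.
    by apply/seteqP; split=> // p _; exists (inv p).
  move=> g; apply/seteqP; split=> // -[x y] _.
  exists (beta g^-1 x, gamma g^-1 y) => //.
  by rewrite /diagonal_act/= -bM -cM mulgV b1 c1.
- by move=> z z' _ _; apply: gdist_iso phiK invK adjE z z'.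
Qed.

End BorelProductTarget.

(** * The measure carried by the orbit map *)

Section OrbitMapMeasure.
Variables (R : realType) (G : groupType) (S : set G) (L : groupClosed G).
Variables (c : G -> nat) (e : nat -> G).
Hypothesis eK : cancel c e.
Hypothesis finL : finite_index L.
Variables (mL : probability (borel (iso_quot S L)) R)
  (mG : probability (borel (iso_quot S (whole G))) R).
Hypotheses (hL : haar_probability mL) (hG : haar_probability mG).

Lemma finite_index_whole : finite_index (whole G).
Proof.
rewrite /finite_index; apply: (@sub_finite_set _ _ [set point]) => // t _ /=.
by rewrite -[t]reprK; apply/cosetP.
Qed.

(** On the section of the cosets the set is a union, over [C], of translates of
    the inverse of [K `&` pi^-1 A], where [K] is the stabilizer of 1; invariance
    under inversion replaces it by [K `&` pi^-1 A], whose measure is [mG A]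
    because [K] is a fundamental domain of [G]. *)
Lemma orbit_map_rectangle
    (A : set (borel (iso_quot S (whole G)))) (C : set (cosets L)) :
  measurable A ->
  mL ((@invert_rooted G S L @^-1` A) `&` (@quot_coset G S L @^-1` C)) =
  (mG A * coset_unif L R C)%E.
Proof.
move=> mA.
have [mu [muL mu1 muE]] := haar_probabilityP eK finL hL.
have [nu [nuL nu1 nuE]] := haar_probabilityP eK finite_index_whole hG.
have mu1oo : (mu (@stab1 G S) < +oo)%E by rewrite mu1 ltry.
have munu : mu (@stab1 G S) = nu (@stab1 G S) by rewrite mu1 nu1.
have ms : measurable (@stab1 G S) by exact: measurable_fiber.
have mpi : measurable (\pi_(iso_quot S (whole G)) @^-1` A : set (borel (Iso S))).
  exact: measurable_preimage_pi.
have mGE : mG A = mu (@stab1 G S `&` \pi_(iso_quot S (whole G)) @^-1` A).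
  rewrite (nuE (@stab1 G S))//; last exact: fiber_fundamental.
  rewrite nu1 inve1 mule1; apply/esym/(haar_unique eK) => //.
  exact: measurableI.
pose B : set (borel (Iso S)) :=
  @iso_inv G S @^-1` (\pi_(iso_quot S (whole G)) @^-1` A).
have mB : measurable B.
  exact: (measurable_preimage_borel (@iso_inv_continuous G S)).
have sB : mu (@stab1 G S `&` B) = mG A.
  rewrite mGE -[RHS](inv_invariant eK muL mu1oo); last exact: measurableI.
  rewrite preimage_setI; congr (mu (_ `&` _)).
  by apply/seteqP; split => f; rewrite /stab1/= => f1; apply/iso_inv_eq.
have fdD := coset_section_fundamental S finL.
have secT : mu (coset_section L) = counting [set: cosets L].
  have := coset_section_measure [set: cosets L] finL muL
    (@measurableT _ (borel (Iso S))).
  rewrite setIT mu1 mule1 => <-; congr (mu _).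
  by apply/seteqP; split => // f [].
have m1 : measurable
    (@invert_rooted G S L @^-1` A : set (borel (iso_quot S L))).
  exact: (measurable_preimage_borel (@invert_rooted_continuous G S L)).
have m2 : measurable
    (@quot_coset G S L @^-1` C : set (borel (iso_quot S L))).
  rewrite -[X in measurable X]setTI.
  exact: (@measurable_quot_coset G S L measurableT C I).
rewrite (muE (coset_section L) _ fdD (measurableI _ _ m1 m2)).
rewrite coset_unifE// secT muleA -sB [(_ * counting C)%E]muleC.
congr (_ / _)%E; rewrite -(coset_section_measure C finL muL mB).
congr (mu (_ `&` _)); apply/seteqP; split => f.
  by rewrite /B/= /invert_rooted quot_rooted_pi quot_coset_pi => -[].
by rewrite /B/= /invert_rooted quot_rooted_pi quot_coset_pi => -[].
Qed.

End OrbitMapMeasure.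

Lemma iso_act_pmp (R : realType) (G : groupType) (S : set G)
    (L : groupClosed G) (m : probability (borel (iso_quot S L)) R)
    (c : G -> nat) (e : nat -> G) :
  cancel c e -> finite_index L -> haar_probability m ->
  pmp_action m (@iso_act G S L).
Proof.
move=> eK finL hm.
apply: pmp_action_borel.
- exact: (standard_borel_iso_quot S L eK R).
- exact: iso_act1.
- exact: iso_actM.
- exact: iso_act_continuous.
- by move=> g A mA; exact: (haar_probability_invariant eK g finL hm mA).
Qed.

Theorem theorem5p2 (R : realType) (G : groupType) (S : set G)
    (L : groupClosed G)
    (mL : probability (borel (iso_quot S L)) R)
    (mG : probability (borel (iso_quot S (whole G))) R) :
  generating_system S ->
  finite_index L ->
  haar_probability mL ->
  haar_probability mG ->
  isometric_orbit_equivalent S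
    mL (@iso_act G S L)
    (product_probability mG (coset_unif L R))
    (diagonal_act (@iso_act G S (whole G)) (@coset_act G L)).
Proof.
move=> genS finL hL hG.
have [c [e eK]] := generating_system_countable genS.
have finG := finite_index_whole G.
apply: (isometric_orbit_equivalent_product (mu := mL) (mX := mG)
  (mY := coset_unif L R) (f1 := @invert_rooted G S L)
  (f2 := @quot_coset G S L) (inv := @orbit_inv G S L)).
- exact: finL.
- by [].
- exact: (iso_act_pmp eK finL hL).
- exact: (iso_act_pmp eK finG hG).
- exact: coset_act1.
- exact: coset_actM.
- by move=> g B; exact: coset_unif_invariant.
- exact: invert_rooted_continuous.
- exact: measurable_quot_coset.
- exact: orbit_inv_continuous.
- exact: orbit_mapK.
- exact: orbit_invK.
- by move=> A B mA; exact: (orbit_map_rectangle eK).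
- by move=> q q'; exact: orbit_map_adj.
Qed.
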